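(* Let $(M_1,\varphi_1,\xi_1,\eta_1,g_1)$ and $(M_2,\varphi_2,\xi_2,\eta_2,g_2)$ be two Sasakian manifolds of dimensions $2n_1+1$ and $2n_2+1$, respectively, with fundamental $2$-forms $\Phi_1$ and $\Phi_2$. Let $a,b\in\mathbb{R}$ with $b\neq 0$, and let $M=M_1\times M_2$ be endowed with the complex structure $$J(X,Y)=\left(\varphi_1(X)-\frac{a}{b}\eta_1(X)\xi_1-\frac{a^2+b^2}{b}\eta_2(Y)\xi_1,\ \varphi_2(Y)+\frac{1}{b}\eta_1(X)\xi_2+\frac{a}{b}\eta_2(Y)\xi_2\right),$$ for $X\in\mathfrak{X}(M_1)$, $Y\in\mathfrak{X}(M_2)$. Let $t\in\mathbb{R}\setminus\{0\}$ with $\frac{t}{b}>0$, and consider the $J$-Hermitian metric on $M$ with fundamental $2$-form $$\Omega=\Phi_1+\Phi_2+t\,\eta_1\wedge\eta_2 .$$ Suppose that $2n=2(n_1+n_2+1)>6$. Then the following are equivalent: (1) $\Omega$ is $1$-st Gauduchon; (2) $\Omega$ is astheno-Kähler; (3) $n_1(n_1-1)+2a\,n_1n_2+(a^2+b^2)\,n_2(n_2-1)=0$.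
   Context: An almost contact metric manifold $(N,\varphi,\xi,\eta,g)$ has fundamental form $\Phi(\cdot,\cdot)=g(\varphi\cdot,\cdot)$; it is quasi-Sasakian if it is normal and $d\Phi=0$, and Sasakian if moreover $d\eta=\Phi$. The fundamental $2$-form of a $J$-Hermitian metric $g$ is $\Omega(\cdot,\cdot)=g(J\cdot,\cdot)$. On a complex manifold of complex dimension $n$, a Hermitian metric with fundamental form $\Omega$ is $1$-st Gauduchon if $\partial\overline{\partial}\Omega\wedge\Omega^{n-2}=0$, and astheno-Kähler if $\partial\overline{\partial}\Omega^{n-2}=0$. Forms on $M_1$, $M_2$ are identified with their pullbacks to $M_1\times M_2$. *)

(* Defs.v *)
(* A manifold is given by an explicit atlas, and every tensor field or form by
   its expressions in the charts.  Vectors are rows: at a point of a chart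
     - a vector X is a 'rV_m, a covector eta a 'cV_m, and eta(X) = X *m eta;
     - an endomorphism A is an 'M_m, and A(X) = X *m A
       (so A after B is the matrix B *m A);
     - a bilinear form g is an 'M_m, and g(X, Y) = X *m g *m Y^T. *)
From HB Require Import structures.
From mathcomp Require Import all_boot all_order all_algebra.
From mathcomp Require Import complex.
From mathcomp Require Import all_classical all_reals all_analysis.

Set Implicit Arguments.
Unset Strict Implicit.
Unset Printing Implicit Defensive.

Import Order.TTheory GRing.Theory Num.Theory.
Import numFieldNormedType.Exports.

Local Open Scope classical_set_scope.
Local Open Scope ring_scope.
Local Open Scope complex_scope.

Definition partial (R : realType) (m : nat) (i : 'I_m)
    (f : 'rV[R]_m -> R) : 'rV[R]_m -> R :=
  fun x => 'D_(delta_mx 0 i) f x.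

(* Class C^oo on U: all iterated partial derivatives are differentiable (hence
   continuous) at every point of U.  U is always open below. *)
Definition smooth_on (R : realType) (m : nat) (U : set 'rV[R]_m)
    (f : 'rV[R]_m -> R) : Prop :=
  forall s : seq 'I_m, forall x, U x ->
    differentiable (foldr (@partial R m) f s) x.

Definition smooth_mx_on (R : realType) (m p q : nat) (U : set 'rV[R]_m)
    (F : 'rV[R]_m -> 'M[R]_(p, q)) : Prop :=
  forall i j, smooth_on U (fun x => F x i j).

Definition lie_bracket (R : realType) (m : nat) (X Y : 'rV[R]_m -> 'rV[R]_m) :
    'rV[R]_m -> 'rV[R]_m :=
  fun x => X x *m jacobian Y x - Y x *m jacobian X x.

Record atlas (R : realType) (m : nat) := Atlas {
  carrier :> topologicalType;
  index : Type;
  dom : index -> set carrier;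
  chart : index -> carrier -> 'rV[R]_m;
  chart_inv : index -> 'rV[R]_m -> carrier
}.
Arguments Atlas {R m}.
Arguments dom {R m a}.
Arguments chart {R m a}.
Arguments chart_inv {R m a}.

Definition chart_image (R : realType) (m : nat) (M : atlas R m) (c : index M) :
    set 'rV[R]_m :=
  chart c @` dom c.

Definition overlap (R : realType) (m : nat) (M : atlas R m) (c c' : index M) :
    set 'rV[R]_m :=
  chart c @` (dom c `&` dom c').

Definition transition (R : realType) (m : nat) (M : atlas R m)
    (c c' : index M) : 'rV[R]_m -> 'rV[R]_m :=
  fun x => chart c' (chart_inv c x).

Record smooth_manifold (R : realType) (m : nat) (M : atlas R m) : Prop := {
  manifold_nonempty : inhabited M;
  manifold_hausdorff : hausdorff_space M;
  manifold_second_countable : @second_countable M;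
  dom_cover : \bigcup_c dom (a := M) c = [set: M];
  dom_open : forall c : index M, open (dom c);
  image_open : forall c : index M, open (chart_image c);
  chart_invK : forall (c : index M) (p : M), dom c p ->
    chart_inv c (chart c p) = p;
  chart_continuous : forall c : index M, {within dom c, continuous (chart c)};
  chart_inv_continuous : forall c : index M,
    {within chart_image c, continuous (chart_inv c)};
  transition_smooth : forall c c' : index M,
    smooth_mx_on (overlap c c') (transition c c')
}.

(* The product atlas; coordinates are concatenated, R^(m1 + m2) = R^m1 x R^m2. *)
Definition prod_atlas (R : realType) (m1 m2 : nat) (M1 : atlas R m1)
    (M2 : atlas R m2) : atlas R (m1 + m2) :=
  Atlas (M1 * M2)%type (index M1 * index M2)%type
    (fun c => dom c.1 `*` dom c.2)
    (fun c p => row_mx (chart c.1 p.1) (chart c.2 p.2))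
    (fun c x => (chart_inv c.1 (lsubmx x), chart_inv c.2 (rsubmx x))).

(* The value of a field in the chart c is meaningful only on chart_image c. *)
Definition local_field (R : realType) (m : nat) (M : atlas R m) (T : Type) :=
  index M -> 'rV[R]_m -> T.

Definition smooth_field (R : realType) (m p q : nat) (M : atlas R m)
    (F : local_field M 'M[R]_(p, q)) : Prop :=
  forall c, smooth_mx_on (chart_image c) (F c).

Definition vector_field (R : realType) (m : nat) (M : atlas R m)
    (X : local_field M 'rV[R]_m) : Prop :=
  smooth_field X /\
  forall c c' x, overlap c c' x ->
    X c' (transition c c' x) = X c x *m jacobian (transition c c') x.

Definition covector_field (R : realType) (m : nat) (M : atlas R m)
    (eta : local_field M 'cV[R]_m) : Prop :=
  smooth_field eta /\
  forall c c' x, overlap c c' x ->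
    eta c x = jacobian (transition c c') x *m eta c' (transition c c' x).

Definition endomorphism_field (R : realType) (m : nat) (M : atlas R m)
    (A : local_field M 'M[R]_m) : Prop :=
  smooth_field A /\
  forall c c' x, overlap c c' x ->
    A c x *m jacobian (transition c c') x =
    jacobian (transition c c') x *m A c' (transition c c' x).

Definition bilinear_field (R : realType) (m : nat) (M : atlas R m)
    (g : local_field M 'M[R]_m) : Prop :=
  smooth_field g /\
  forall c c' x, overlap c c' x ->
    g c x = jacobian (transition c c') x *m g c' (transition c c' x)
              *m (jacobian (transition c c') x)^T.

Definition riemannian_metric (R : realType) (m : nat) (M : atlas R m)
    (g : local_field M 'M[R]_m) : Prop :=
  bilinear_field g /\
  forall c x, chart_image c x ->
    (g c x)^T = g c x /\
    forall X : 'rV[R]_m, X != 0 -> 0 < (X *m g c x *m X^T) 0 0.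

(* w : ext K m stands for \sum_S w_S dx^S with
   dx^S = dx^i1 /\ ... /\ dx^ik for S = {i1 < ... < ik}, where
   (dx^i /\ dx^j)(X, Y) = X_i Y_j - X_j Y_i. *)
Definition ext (K : nzRingType) (m : nat) := {ffun {set 'I_m} -> K}.

Definition ext1 (K : nzRingType) (m : nat) : ext K m :=
  [ffun S : {set 'I_m} => (S == finset.set0)%:R].

(* dx^A /\ dx^B = (-1)^(inversions A B) dx^(A u B) for disjoint A and B *)
Definition inversions (m : nat) (A B : {set 'I_m}) : nat :=
  #|[set ij : 'I_m * 'I_m | [&& ij.1 \in A, ij.2 \in B & (ij.2 < ij.1)%N]]%SET|.

Definition wedge (K : nzRingType) (m : nat) (v w : ext K m) : ext K m :=
  [ffun S : {set 'I_m} => \sum_(A : {set 'I_m} | A \subset S)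
     (-1) ^+ inversions A (S :\: A)%SET * v A * w (S :\: A)%SET].

Definition wedge_pow (K : nzRingType) (m : nat) (v : ext K m) (k : nat) :
    ext K m :=
  iter k (wedge v) (ext1 K m).

Definition one_form (K : nzRingType) (m : nat) (eta : 'cV[K]_m) : ext K m :=
  [ffun S : {set 'I_m} => \sum_(i | S == [set i]%SET) eta i 0].

(* The 2-form (X, Y) |-> X *m B *m Y^T, for an antisymmetric B. *)
Definition two_form (K : nzRingType) (m : nat) (B : 'M[K]_m) : ext K m :=
  [ffun S : {set 'I_m} =>
     \sum_(i : 'I_m) \sum_(j : 'I_m | (i < j)%N && (S == [set i; j]%SET))
        B i j].

Definition ext_toC (R : realType) (m : nat) (w : ext R m) : ext R[i] m :=
  [ffun S => (w S)%:C].

Definition cpartial (R : realType) (m : nat) (i : 'I_m)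
    (f : 'rV[R]_m -> R[i]) : 'rV[R]_m -> R[i] :=
  fun x => partial i (fun y => complex.Re (f y)) x +i*
           partial i (fun y => complex.Im (f y)) x.

(* d w = \sum_i dx^i /\ D_i w, for the partial derivatives D of K-valued
   functions; no factors 1/(k+1), so
   d eta (X, Y) = X(eta Y) - Y(eta X) - eta [X, Y]. *)
Definition ext_deriv (R : realType) (K : nzRingType) (m : nat)
    (D : 'I_m -> ('rV[R]_m -> K) -> 'rV[R]_m -> K)
    (w : 'rV[R]_m -> ext K m) : 'rV[R]_m -> ext K m :=
  fun x => [ffun S : {set 'I_m} =>
    \sum_(i in S) (-1) ^+ #|[set j in S | (j < i)%N]%SET| *
                  D i (fun y => w y (S :\ i)%SET) x].

Definition dR (R : realType) (m : nat) : ('rV[R]_m -> ext R m) -> _ :=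
  ext_deriv (@partial R m).

Definition dC (R : realType) (m : nat) : ('rV[R]_m -> ext R[i] m) -> _ :=
  ext_deriv (@cpartial R m).

(* The projections (1 - iJ)/2 and (1 + iJ)/2 of the complexified tangent space
   onto T^{1,0} and T^{0,1}. *)
Definition proj10 (R : realType) (m : nat) (J : 'M[R]_m) : 'M[R[i]]_m :=
  2^-1 *: (1%:M - 'i *: map_mx (real_complex R) J).
Definition proj01 (R : realType) (m : nat) (J : 'M[R]_m) : 'M[R[i]]_m :=
  2^-1 *: (1%:M + 'i *: map_mx (real_complex R) J).

(* The component of bidegree (p, q): every dx^i in dx^S is split into its (1,0)
   part dx^i o proj10 and its (0,1) part dx^i o proj01, the product is expanded,
   and only the terms with p factors of type (1,0) and q of type (0,1) are kept.
   enum S lists S in increasing order. *)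
Definition bidegree (R : realType) (m : nat) (J : 'M[R]_m) (p q : nat)
    (w : ext R[i] m) : ext R[i] m :=
  \sum_(S : {set 'I_m} | #|S| == (p + q)%N)
  \sum_(A : {set 'I_m} | (A \subset S) && (#|A| == p))
    [ffun T => w S *
      (\big[@wedge R[i] m/ext1 R[i] m]_(i <- enum S)
         one_form (col i (if i \in A then proj10 J else proj01 J))) T].

(* These make sense for every almost complex structure.  On forms of bidegree
   (p, q), del is the (p + 1, q) component of d and delbar the
   (p, q + 1) component. *)
Definition del (R : realType) (m : nat) (J : 'rV[R]_m -> 'M[R]_m)
    (w : 'rV[R]_m -> ext R[i] m) : 'rV[R]_m -> ext R[i] m :=
  fun x => \sum_(p < m.+1) \sum_(q < m.+1)
    bidegree (J x) p.+1 q (dC (fun y => bidegree (J y) p q (w y)) x).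

Definition delbar (R : realType) (m : nat) (J : 'rV[R]_m -> 'M[R]_m)
    (w : 'rV[R]_m -> ext R[i] m) : 'rV[R]_m -> ext R[i] m :=
  fun x => \sum_(p < m.+1) \sum_(q < m.+1)
    bidegree (J x) p q.+1 (dC (fun y => bidegree (J y) p q (w y)) x).

Record contact_data (R : realType) (m : nat) (M : atlas R m) := ContactData {
  phi : local_field M 'M[R]_m;
  xi : local_field M 'rV[R]_m;
  eta : local_field M 'cV[R]_m;
  met : local_field M 'M[R]_m
}.

Record almost_contact_metric (R : realType) (m : nat) (M : atlas R m)
    (s : contact_data M) : Prop := {
  phi_field : endomorphism_field (phi s);
  xi_field : vector_field (xi s);
  eta_field : covector_field (eta s);
  met_field : riemannian_metric (met s);
  eta_xi : forall c x, chart_image c x -> xi s c x *m eta s c x = 1%:M;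
  (* phi^2 = - id + eta (x) xi *)
  phi_sqr : forall c x, chart_image c x ->
    phi s c x *m phi s c x = - 1%:M + eta s c x *m xi s c x;
  (* g(phi X, phi Y) = g(X, Y) - eta(X) eta(Y) *)
  phi_met : forall c x, chart_image c x ->
    phi s c x *m met s c x *m (phi s c x)^T =
    met s c x - eta s c x *m (eta s c x)^T
}.

(* Phi(X, Y) = g(phi X, Y) *)
Definition contact_form (R : realType) (m : nat) (M : atlas R m)
    (s : contact_data M) : local_field M (ext R m) :=
  fun c x => two_form (phi s c x *m met s c x).

Definition eta_form (R : realType) (m : nat) (M : atlas R m)
    (s : contact_data M) : local_field M (ext R m) :=
  fun c x => one_form (eta s c x).

(* [A, A](X, Y) = A^2 [X, Y] + [A X, A Y] - A [A X, Y] - A [X, A Y] *)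
Definition nijenhuis (R : realType) (m : nat) (A : 'rV[R]_m -> 'M[R]_m)
    (X Y : 'rV[R]_m -> 'rV[R]_m) : 'rV[R]_m -> 'rV[R]_m :=
  let AX := fun x => X x *m A x in
  let AY := fun x => Y x *m A x in
  fun x => lie_bracket X Y x *m A x *m A x + lie_bracket AX AY x
           - lie_bracket AX Y x *m A x - lie_bracket X AY x *m A x.

(* d eta (X, Y); the same normalisation as in ext_deriv *)
Definition d_covector (R : realType) (m : nat) (eta : 'rV[R]_m -> 'cV[R]_m)
    (X Y : 'rV[R]_m -> 'rV[R]_m) (x : 'rV[R]_m) : R :=
  'D_(X x) (fun y => (Y y *m eta y) 0 0) x
  - 'D_(Y x) (fun y => (X y *m eta y) 0 0) x
  - (lie_bracket X Y x *m eta x) 0 0.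

(* [phi, phi] + d eta (x) xi = 0.  With (1/2)-normalised exterior derivatives
   this is the usual [phi, phi] + 2 d eta (x) xi = 0; it is equivalent to the
   integrability of (X, f d/dt) |-> (phi X - f xi, eta(X) d/dt) on N x R. *)
Definition normal (R : realType) (m : nat) (M : atlas R m)
    (s : contact_data M) : Prop :=
  forall c (X Y : 'rV[R]_m -> 'rV[R]_m),
    smooth_mx_on (chart_image c) X -> smooth_mx_on (chart_image c) Y ->
    forall x, chart_image c x ->
      nijenhuis (phi s c) X Y x + d_covector (eta s c) X Y x *: xi s c x = 0.

Definition quasi_sasakian (R : realType) (m : nat) (M : atlas R m)
    (s : contact_data M) : Prop :=
  [/\ almost_contact_metric s, normal s &
      forall c x, chart_image c x -> dR (contact_form s c) x = 0].

Definition sasakian (R : realType) (m : nat) (M : atlas R m)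
    (s : contact_data M) : Prop :=
  quasi_sasakian s /\
  forall c x, chart_image c x -> dR (eta_form s c) x = contact_form s c x.

Definition hermitian_metric (R : realType) (m : nat) (M : atlas R m)
    (J g : local_field M 'M[R]_m) : Prop :=
  riemannian_metric g /\
  forall c x, chart_image c x -> J c x *m g c x *m (J c x)^T = g c x.

(* Omega(X, Y) = g(J X, Y) *)
Definition fundamental_form (R : realType) (m : nat) (M : atlas R m)
    (J g : local_field M 'M[R]_m) : local_field M (ext R m) :=
  fun c x => two_form (J c x *m g c x).

(* In the next two definitions n is the complex dimension of M. *)
Definition first_gauduchon (R : realType) (m n : nat) (M : atlas R m)
    (J g : local_field M 'M[R]_m) : Prop :=
  let Omega := fundamental_form J g in
  forall c x, chart_image c x ->
    wedge (del (J c) (delbar (J c) (fun y => ext_toC (Omega c y))) x)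
          (wedge_pow (ext_toC (Omega c x)) (n - 2)) = 0.

Definition astheno_kahler (R : realType) (m n : nat) (M : atlas R m)
    (J g : local_field M 'M[R]_m) : Prop :=
  let Omega := fundamental_form J g in
  forall c x, chart_image c x ->
    del (J c) (delbar (J c)
      (fun y => wedge_pow (ext_toC (Omega c y)) (n - 2))) x = 0.

Definition pullback1 (R : realType) (m1 m2 : nat) (M1 : atlas R m1)
    (M2 : atlas R m2) (w : local_field M1 (ext R m1)) :
    local_field (prod_atlas M1 M2) (ext R (m1 + m2)) :=
  fun c x => [ffun S : {set 'I_(m1 + m2)} =>
    if S \subset [set lshift m2 i | i : 'I_m1]%SET
    then w c.1 (lsubmx x) [set i | lshift m2 i \in S]%SET else 0].

Definition pullback2 (R : realType) (m1 m2 : nat) (M1 : atlas R m1)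
    (M2 : atlas R m2) (w : local_field M2 (ext R m2)) :
    local_field (prod_atlas M1 M2) (ext R (m1 + m2)) :=
  fun c x => [ffun S : {set 'I_(m1 + m2)} =>
    if S \subset [set rshift m1 i | i : 'I_m2]%SET
    then w c.2 (rsubmx x) [set i | rshift m1 i \in S]%SET else 0].

Definition prod_complex_structure (R : realType) (m1 m2 : nat)
    (M1 : atlas R m1) (M2 : atlas R m2) (s1 : contact_data M1)
    (s2 : contact_data M2) (a b : R) :
    local_field (prod_atlas M1 M2) 'M[R]_(m1 + m2) :=
  fun c x =>
    let x1 := lsubmx x in let x2 := rsubmx x in
    let phi1 := phi s1 c.1 x1 in let phi2 := phi s2 c.2 x2 in
    let xi1 := xi s1 c.1 x1 in let xi2 := xi s2 c.2 x2 in
    let eta1 X := (X *m eta s1 c.1 x1) 0 0 in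
    let eta2 Y := (Y *m eta s2 c.2 x2) 0 0 in
    lin1_mx (fun Z : 'rV[R]_(m1 + m2) =>
      let X := lsubmx Z in let Y := rsubmx Z in
      row_mx
        (X *m phi1 - (a / b * eta1 X) *: xi1
           - ((a ^+ 2 + b ^+ 2) / b * eta2 Y) *: xi1)
        (Y *m phi2 + (b^-1 * eta1 X) *: xi2 + (a / b * eta2 Y) *: xi2)).

Definition prod_fundamental_form (R : realType) (m1 m2 : nat)
    (M1 : atlas R m1) (M2 : atlas R m2) (s1 : contact_data M1)
    (s2 : contact_data M2) (t : R) :
    local_field (prod_atlas M1 M2) (ext R (m1 + m2)) :=
  fun c x =>
    pullback1 (M2 := M2) (contact_form s1) c x
    + pullback2 (M1 := M1) (contact_form s2) c x
    + [ffun S => t * wedge (pullback1 (M2 := M2) (eta_form s1) c x)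
                           (pullback2 (M1 := M1) (eta_form s2) c x) S].

(* Main.v *)
Require Import Defs.
From HB Require Import structures.
From mathcomp Require Import all_boot all_order all_algebra.
From mathcomp Require Import complex.
From mathcomp Require Import ring lra zify.
Set Implicit Arguments.
Unset Strict Implicit.
Unset Printing Implicit Defensive.
Import Order.TTheory GRing.Theory Num.Theory.
Local Open Scope ring_scope.

(** The forms at issue all lie in the algebra generated by the lifts f1, f2 of
    the two contact forms and e1, e2 of the two characteristic 1-forms.  The
    Sasakian condition says d e1 = f1, d e2 = f2 and d f1 = d f2 = 0.  The complex
    structure acts on the span of e1 and e2 by constant coefficients, so the
    (0,1)-parts e1'', e2'' are constant combinations of e1 and e2 and their
    differentials are constant combinations of f1 and f2; the phi-invariance of the
    contact forms makes f1 and f2 of type (1,1).  Write F = f1 + f2.  Since 2-forms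
    are central and the square of e1 e2 is 0,

      Omega^(k+1) = F^(k+1) + (k+1) t F^k e1 e2,
      delbar Omega^(k+1) = (k+1) t F^k (f1 e2'' - e1'' f2),
      del delbar Omega^(k+1)
        = (k+1) (i t / 2b) F^k (f1^2 + 2a f1 f2 + (a^2 + b^2) f2^2).

    The last line is [del_delbar_OmegaX]; it serves both conditions, with k = 0 for
    the first Gauduchon one and k + 1 = n - 2 for the astheno-Kahler one.

    Let N = n1 + n2 = n - 1.  By degree f1^(n1+1) = 0 and f2^(n2+1) = 0, so a
    monomial of degree N in f1, f2 vanishes unless it is f1^n1 f2^n2.  Hence F^(N-2)
    times the quadric above is (N-2)!/(n1! n2!) times the polynomial of the third
    condition times f1^n1 f2^n2 ([quadric_exp]).  The astheno-Kahler form is a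
    nonzero multiple of this product, and the first Gauduchon form is a nonzero
    multiple of it times e1 e2.

    It remains to know that f1^n1 f2^n2 e1 e2 is nonzero.  Omega is the
    fundamental form of a positive definite metric, hence a nondegenerate 2-form,
    and its top power is nonzero ([two_form_nondegenerate]); by the expansion above
    that power is a multiple of f1^n1 f2^n2 e1 e2.

    Bidegrees are handled through substitution: replacing every covector dx by
    c dx' + d dx'', where dx' and dx'' are its (1,0) and (0,1) parts, is an algebra
    morphism, and it multiplies forms of bidegree (p, q) by c^p d^q.  A form with
    this property for all c and d equals its (p, q) component, and the property is
    visibly multiplicative. *)

(** * The Grassmann algebra *)

Section Inversions.
Variable m : nat.
Implicit Types A B C : {set 'I_m}.

Lemma inversionsE A B :
  inversions A B = (\sum_(i in A) \sum_(j in B) (j < i)%N)%N.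
Proof.
rewrite /inversions pair_big_dep /= -sum1dep_card [LHS]big_mkcond [RHS]big_mkcond /=.
by apply: eq_bigr => -[i j] _ /=; do 2![case: (_ \in _) => //=]; case: (_ < _)%N.
Qed.

Lemma inversions_Ul A B C : [disjoint A & B] ->
  inversions (A :|: B) C = (inversions A C + inversions B C)%N.
Proof.
move=> dAB; rewrite !inversionsE -bigU //=.
by apply: eq_bigl => i; rewrite !inE.
Qed.

Lemma inversions_Ur A B C : [disjoint B & C] ->
  inversions A (B :|: C) = (inversions A B + inversions A C)%N.
Proof.
move=> dBC; rewrite !inversionsE -big_split /=.
apply: eq_bigr => i _; rewrite -bigU //=.
by apply: eq_bigl => j; rewrite !inE.
Qed.

(** Of two distinct indices, exactly one order is an inversion, so every pair of
    A x B is counted once. *)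
Lemma inversionsC A B : [disjoint A & B] ->
  (inversions A B + inversions B A = #|A| * #|B|)%N.
Proof.
move=> dAB; rewrite !inversionsE [in X in (_ + X)%N]exchange_big /= -big_split /=.
rewrite -sum_nat_const; apply: eq_bigr => i iA; rewrite -big_split /= -sum1_card.
apply: eq_bigr => j jB; case: (ltngtP i j) => // /val_inj eij.
by move/pred0P/(_ i): dAB => /=; rewrite iA eij jB.
Qed.

Lemma inversions1 i A : inversions [set i] A = #|[set j in A | (j < i)%N]|.
Proof.
rewrite inversionsE big_set1 -sum1dep_card [RHS]big_mkcondr /=.
by apply: eq_bigr => j _; case: ifP.
Qed.

End Inversions.

(** As a type of finite functions, [ext K m] already has the pointwise product;
    the wedge product is made the product of this copy. *)
Definition grassmann (K : nzRingType) (m : nat) : Type := ext K m.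

Section GrassmannRing.
Variables (K : comNzRingType) (m : nat).
Implicit Types (u v w : ext K m) (S A B : {set 'I_m}) (c d : K).

(** Both sides are the sum over ordered partitions of S into three blocks A, B and
    the rest, signed by the inversions between the blocks. *)
Lemma wedgeA : associative (@wedge K m).
Proof.
move=> u v w; apply/ffunP => S; rewrite !ffunE.
transitivity (\sum_(A : {set 'I_m} | A \subset S)
   \sum_(B : {set 'I_m} | B \subset S :\: A)
     (-1) ^+ (inversions A B + inversions (A :|: B) (S :\: (A :|: B)))
     * (u A * v B * w (S :\: (A :|: B)))).
  apply: eq_bigr => A sAS; rewrite ffunE mulr_sumr; apply: eq_bigr => B BSA.
  have dAB : [disjoint A & B].
    by move: BSA; rewrite subsetD disjoint_sym => /andP[].
  have eS : S :\: A = B :|: S :\: (A :|: B).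
    by rewrite -setDDl -[LHS](setID _ B) (setIidPr BSA).
  rewrite {1}eS inversions_Ur; last first.
    by rewrite disjoint_sym; apply/setDidPl; rewrite setDDl -setUA setUid.
  rewrite inversions_Ul // setDDl !exprD; ring.
transitivity (\sum_(A : {set 'I_m} | A \subset S)
   \sum_(C : {set 'I_m} | (C \subset S) && (A \subset C))
     (-1) ^+ (inversions A (C :\: A) + inversions C (S :\: C))
     * (u A * v (C :\: A) * w (S :\: C))).
  apply: eq_bigr => A sAS.
  rewrite [RHS](reindex_onto (fun B => A :|: B) (fun C => C :\: A)) /=; last first.
    by move=> C /andP[_ sAC]; rewrite -[RHS](setID _ A) (setIidPr sAC).
  have E B : (B \subset S :\: A) = (A :|: B \subset S) && (A \subset A :|: B)
        && ((A :|: B) :\: A == B).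
    rewrite subsetUl andbT subUset sAS /= subsetD; congr (_ && _).
    by rewrite setDUl setDv set0U; apply/idP/eqP => /setDidPl.
  apply: eq_big => // B; rewrite E => /andP[_ /eqP->] //.
rewrite (exchange_big_dep (fun C : {set 'I_m} => C \subset S)) /=; last by move=> A C _ /andP[].
apply: eq_bigr => C CS; rewrite ffunE mulr_sumr mulr_suml.
apply: eq_big => [A|A /andP[_ sAC]].
  by rewrite CS /=; case sAC: (A \subset C); rewrite ?andbF // (subset_trans sAC CS).
rewrite !exprD; ring.
Qed.

Lemma wedge1l : left_id (ext1 K m) (@wedge K m).
Proof.
move=> w; apply/ffunP => S; rewrite ffunE (bigD1 finset.set0) ?sub0set //=.
rewrite ffunE eqxx mulr1 setD0 inversionsE big_set0 expr0 mul1r big1 ?addr0 //.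
by move=> A /andP[_ /negPf A0]; rewrite ffunE A0 mulr0 mul0r.
Qed.

Lemma wedge1r : right_id (ext1 K m) (@wedge K m).
Proof.
move=> w; apply/ffunP => S; rewrite ffunE (bigD1 S) //=.
rewrite ffunE setDv eqxx mulr1 inversionsE big1 ?expr0 ?mul1r; last first.
  by move=> i _; rewrite big_set0.
rewrite big1 ?addr0 // => A /andP[sAS nAS].
rewrite ffunE setD_eq0; case: (boolP (S \subset A)) => SA; last by rewrite mulr0.
by case/eqP: nAS; apply/eqP; rewrite eqEsubset sAS.
Qed.

HB.instance Definition _ :=
  GRing.Zmodule.copy (grassmann K m) {ffun {set 'I_m} -> K}.

Fact grassmann_mulDl : left_distributive
  (@wedge K m : grassmann K m -> grassmann K m -> grassmann K m) +%R.
Proof.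
move=> u v w; apply/ffunP => S; rewrite !ffunE -big_split /=.
by apply: eq_bigr => A _; rewrite ffunE mulrDr mulrDl.
Qed.

Fact grassmann_mulDr : right_distributive
  (@wedge K m : grassmann K m -> grassmann K m -> grassmann K m) +%R.
Proof.
move=> u v w; apply/ffunP => S; rewrite !ffunE -big_split /=.
by apply: eq_bigr => A _; rewrite ffunE mulrDr.
Qed.

Fact grassmann_oner_neq0 : (ext1 K m : grassmann K m) != 0.
Proof.
by apply/eqP => /ffunP/(_ finset.set0); rewrite !ffunE eqxx; apply/eqP/oner_neq0.
Qed.

HB.instance Definition _ := GRing.Zmodule_isNzRing.Build (grassmann K m)
  wedgeA wedge1l wedge1r grassmann_mulDl grassmann_mulDr grassmann_oner_neq0.

Definition grassmann_scale c (w : grassmann K m) : grassmann K m :=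
  [ffun S => c * (w : ext K m) S].

Fact grassmann_scaleA c d w :
  grassmann_scale c (grassmann_scale d w) = grassmann_scale (c * d) w.
Proof. by apply/ffunP => S; rewrite !ffunE mulrA. Qed.

Fact grassmann_scale1 : left_id 1 grassmann_scale.
Proof. by move=> w; apply/ffunP => S; rewrite !ffunE mul1r. Qed.

Fact grassmann_scaleDr : right_distributive grassmann_scale +%R.
Proof. by move=> c v w; apply/ffunP => S; rewrite !ffunE mulrDr. Qed.

Fact grassmann_scaleDl w : {morph grassmann_scale^~ w : c d / c + d}.
Proof. by move=> c d; apply/ffunP => S; rewrite !ffunE mulrDl. Qed.

HB.instance Definition _ := GRing.Zmodule_isLmodule.Build K (grassmann K m)
  grassmann_scaleA grassmann_scale1 grassmann_scaleDr grassmann_scaleDl.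

Fact grassmann_scaleAl c (v w : grassmann K m) : c *: (v * w) = (c *: v) * w.
Proof.
apply/ffunP => S; rewrite !ffunE mulr_sumr; apply: eq_bigr => A _.
by rewrite ffunE; ring.
Qed.

HB.instance Definition _ :=
  GRing.Lmodule_isLalgebra.Build K (grassmann K m) grassmann_scaleAl.

Fact grassmann_scaleAr c (v w : grassmann K m) : c *: (v * w) = v * (c *: w).
Proof.
apply/ffunP => S; rewrite !ffunE mulr_sumr; apply: eq_bigr => A _.
by rewrite ffunE; ring.
Qed.

HB.instance Definition _ :=
  GRing.Lalgebra_isAlgebra.Build K (grassmann K m) grassmann_scaleAr.

End GrassmannRing.

Section Monomials.
Variables (K : comNzRingType) (m : nat).
Implicit Types (v w : grassmann K m) (A B S T D : {set 'I_m}) (c : K) (k l : nat).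

Definition monomial S : grassmann K m := [ffun T : {set 'I_m} => (T == S)%:R].
Definition dx i : grassmann K m := monomial [set i].

Lemma grassmannDE v w S : (v + w) S = v S + w S. Proof. exact: ffunE. Qed.
Lemma grassmannZE c w S : (c *: w) S = c * w S. Proof. exact: ffunE. Qed.
Lemma grassmann0E S : (0 : grassmann K m) S = 0. Proof. exact: ffunE. Qed.
Lemma grassmannME v w S : (v * w) S = \sum_(A : {set 'I_m} | A \subset S)
  (-1) ^+ inversions A (S :\: A) * v A * w (S :\: A).
Proof. exact: ffunE. Qed.
Lemma grassmann_sumE (I : Type) (r : seq I) (P : pred I)
    (F : I -> grassmann K m) S :
  (\sum_(i <- r | P i) F i) S = \sum_(i <- r | P i) F i S.
Proof.
by apply: (big_morph (fun w : grassmann K m => w S) _ (grassmann0E S)) => v w; exact: grassmannDE.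
Qed.

Lemma wedge_powE w k : wedge_pow w k = w ^+ k.
Proof. by elim: k => // k IHk; rewrite exprS -IHk. Qed.

Lemma monomial0 : monomial set0 = 1.
Proof. by []. Qed.

Lemma grassmann_expand w : w = \sum_S w S *: monomial S.
Proof.
apply/ffunP => T; rewrite grassmann_sumE (bigD1 T) //= big1 ?addr0.
  by rewrite grassmannZE ffunE eqxx mulr1.
by move=> S /negPf nST; rewrite grassmannZE ffunE eq_sym nST mulr0.
Qed.

Lemma monomialM A B : [disjoint A & B] ->
  monomial A * monomial B = (-1) ^+ inversions A B *: monomial (A :|: B).
Proof.
move=> dAB; apply/ffunP => S; rewrite grassmannME grassmannZE ffunE.
have [sAS|nAS] := boolP (A \subset S); last first.
  have -> : (S == A :|: B) = false.
    by apply/negP => /eqP eS; rewrite eS subsetUl in nAS.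
  rewrite mulr0 big1 //.
  move=> C sCS; rewrite ffunE (_ : C == A = false) ?mulr0 ?mul0r //.
  by apply/negP => /eqP eC; rewrite -eC sCS in nAS.
rewrite (bigD1 A) //= big1 ?addr0; last first.
  by move=> C /andP[_ /negPf nCA]; rewrite ffunE nCA mulr0 mul0r.
rewrite !ffunE eqxx mulr1; have -> : (S == A :|: B) = (S :\: A == B).
  apply/eqP/eqP => [->|<-]; last by rewrite setDE setUIr setUCr setIT (setUidPr sAS).
  by rewrite setDUl setDv set0U; apply/setDidPl; rewrite disjoint_sym.
by case: eqP => [->|]; rewrite ?mulr0.
Qed.

Lemma mul_dxE i w S : (dx i * w) S =
  if i \in S then (-1) ^+ #|[set j in S | (j < i)%N]| * w (S :\ i) else 0.
Proof.
rewrite grassmannME; case: (boolP (i \in S)) => iS; last first.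
  rewrite big1 // => A sAS; rewrite ffunE (_ : A == _ = false) ?mulr0 ?mul0r //.
  by apply/negP => /eqP eA; rewrite eA sub1set (negPf iS) in sAS.
rewrite (bigD1 [set i]) ?sub1set //= big1 ?addr0; last first.
  by move=> C /andP[_ /negPf nCA]; rewrite ffunE nCA mulr0 mul0r.
rewrite ffunE eqxx mulr1 inversions1; congr (_ ^+ _ * _); apply: eq_card => j.
by rewrite !inE; case: eqP => [->|]; rewrite ?ltnn ?andbF.
Qed.

Lemma one_formE (a : 'cV[K]_m) : one_form a = \sum_i a i 0 *: dx i :> grassmann K m.
Proof.
apply/ffunP => S; rewrite grassmann_sumE ffunE [LHS]big_mkcond /=.
apply: eq_bigr => i _; rewrite grassmannZE ffunE.
by case: ifP; rewrite ?mulr1 ?mulr0.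
Qed.

Lemma one_formZ (c : K) (a : 'cV[K]_m) :
  one_form (c *: a) = c *: (one_form a : grassmann K m).
Proof. by rewrite !one_formE scaler_sumr; apply: eq_bigr => i _; rewrite mxE scalerA. Qed.

Lemma one_formD (a b : 'cV[K]_m) :
  one_form (a + b) = (one_form a : grassmann K m) + one_form b.
Proof.
by rewrite !one_formE -big_split; apply: eq_bigr => i _; rewrite mxE scalerDl.
Qed.

(** Homogeneous forms in the covectors dx^i with i in D.  Recording D and not
    only the degree is what makes forms lifted from a factor vanish in degrees
    above the dimension of that factor. *)
Definition form_in (D : {set 'I_m}) (k : nat) : {pred grassmann K m} :=
  [pred w : grassmann K m |
    [forall S : {set 'I_m}, (w S != 0) ==> (S \subset D) && (#|S| == k)]].

Lemma form_inP D k w : reflect (forall S, w S != 0 -> S \subset D /\ #|S| = k)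
  (w \in form_in D k).
Proof.
apply: (iffP forallP) => h S; first by move=> wS; have /implyP/(_ wS)/andP[-> /eqP] := h S.
by apply/implyP => /h[-> /eqP].
Qed.

Fact form_in_submod_closed D k : submod_closed (form_in D k).
Proof.
split=> [|c v w /form_inP hv /form_inP hw]; apply/form_inP => S.
  by rewrite grassmann0E eqxx.
rewrite grassmannDE grassmannZE; have [v0|vS _] := eqVneq (v S) 0; last exact: hv.
by rewrite v0 mulr0 add0r => /hw.
Qed.
HB.instance Definition _ D k := GRing.isSubmodClosed.Build K (grassmann K m)
  (form_in D k) (form_in_submod_closed D k).

Lemma form_in1 D : 1 \in form_in D 0.
Proof.
apply/form_inP => S; rewrite ffunE; case: (S =P set0) => [-> _|]; last by rewrite eqxx.
by rewrite sub0set cards0.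
Qed.

Lemma form_inM D k l v w :
  v \in form_in D k -> w \in form_in D l -> v * w \in form_in D (k + l).
Proof.
move=> /form_inP hv /form_inP hw; apply/form_inP => S; rewrite grassmannME.
case: (boolP ((S \subset D) && (#|S| == k + l)%N)) => [/andP[-> /eqP] //|nS].
rewrite big1 ?eqxx // => A sAS.
have [->|vA] := eqVneq (v A) 0; first by rewrite mulr0 mul0r.
have [->|wA] := eqVneq (w (S :\: A)) 0; first by rewrite mulr0.
have [AD Ak] := hv _ vA; have [SD Sl] := hw _ wA; case/negP: nS.
have -> : S = A :|: S :\: A by rewrite setDE setUIr setUCr setIT (setUidPr sAS).
rewrite subUset AD SD /= cardsU Ak Sl setDE setICA setICr setI0 cards0 subn0.
exact: eqxx.
Qed.

Lemma form_inX D k n w : w \in form_in D k -> w ^+ n \in form_in D (n * k).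
Proof.
move=> hw; elim: n => [|n IHn]; first exact: form_in1.
by rewrite exprS mulSn form_inM.
Qed.

Lemma form_in_sub D (D' : {set 'I_m}) k w : D \subset D' -> w \in form_in D k -> w \in form_in D' k.
Proof.
move=> sDD /form_inP hw; apply/form_inP => S /hw[SD ->]; split=> //.
exact: subset_trans SD sDD.
Qed.

Lemma form_in_large D k w : (#|D| < k)%N -> w \in form_in D k -> w = 0.
Proof.
move=> ltk /form_inP hw; apply/ffunP => S; rewrite grassmann0E.
have [//|/hw[/subset_leq_card + eS]] := eqVneq (w S) 0.
by rewrite eS leqNgt ltk.
Qed.

Lemma form_in_monomial D S : S \subset D -> monomial S \in form_in D #|S|.
Proof.
move=> SD; apply/form_inP => T; rewrite ffunE.
by case: (T =P S) => [->|]; rewrite ?eqxx.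
Qed.

Lemma form_in_dx (D : {set 'I_m}) i : i \in D -> dx i \in form_in D 1.
Proof. by rewrite -(cards1 i) -sub1set; exact: form_in_monomial. Qed.

Lemma form_in_one_form (a : 'cV[K]_m) : (one_form a : grassmann K m) \in form_in setT 1.
Proof.
by rewrite one_formE rpred_sum // => i _; rewrite rpredZ ?form_in_dx.
Qed.

(** Exchanging two blocks of indices A and B changes the number of inversions to
    its complement in #|A| * #|B|. *)
Lemma grassmann_graded_comm D (D' : {set 'I_m}) k l v w :
  v \in form_in D k -> w \in form_in D' l -> v * w = (-1) ^+ (k * l) *: (w * v).
Proof.
move=> /form_inP hv /form_inP hw; apply/ffunP => S.
rewrite grassmannZE !grassmannME mulr_sumr.
rewrite [RHS](reindex_onto (fun A => S :\: A) (fun A => S :\: A)) /=; last first.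
  by move=> A AS; rewrite setDDr setDv set0U (setIidPr AS).
have E (A : {set 'I_m}) : (A \subset S) = (S :\: A \subset S) && (S :\: (S :\: A) == A).
  rewrite subsetDl /= setDDr setDv set0U; apply/idP/eqP => [/setIidPr //|<-].
  exact: subsetIl.
apply: eq_big => // A; rewrite E => /andP[_ /eqP ->].
have [->|vA] := eqVneq (v A) 0; first by rewrite !(mulr0, mul0r).
have [->|wA] := eqVneq (w (S :\: A)) 0; first by rewrite !(mulr0, mul0r).
have [_ <-] := hv _ vA; have [_ <-] := hw _ wA.
rewrite -inversionsC; last by rewrite disjoint_sym; apply/setDidPl; rewrite setDDl setUid.
have sq : (-1) ^+ inversions (S :\: A) A * (-1) ^+ inversions (S :\: A) A = 1 :> K.
  by rewrite -expr2 sqrr_sign.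
rewrite exprD mulrACA -mulrA; transitivity
  ((-1) ^+ inversions (S :\: A) A * (-1) ^+ inversions (S :\: A) A
   * ((-1) ^+ inversions A (S :\: A) * (v A * w (S :\: A)))); last by ring.
by rewrite sq mul1r.
Qed.

Lemma form_in_even_comm D k v w : v \in form_in D k -> ~~ odd k -> v * w = w * v.
Proof.
move=> hv ek; rewrite [w]grassmann_expand mulr_sumr mulr_suml; apply: eq_bigr => S _.
rewrite -scalerAr -scalerAl (grassmann_graded_comm hv (form_in_monomial (subxx S))).
by rewrite -signr_odd oddM (negPf ek) scale1r.
Qed.

Lemma form_in_odd_sqr (h2 : GRing.lreg (2%:R : K)) D k v :
  v \in form_in D k -> odd k -> v * v = 0.
Proof.
move=> hv ok; have := grassmann_graded_comm hv hv.
rewrite -signr_odd oddM ok expr1 scaleN1r => /eqP; rewrite -addr_eq0 => /eqP vv.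
apply/ffunP => S; apply: h2; move/ffunP/(_ S): vv.
by rewrite grassmannDE grassmann0E -mulr2n mulr_natl mulr0.
Qed.

Lemma dx_anticomm i j : dx i * dx j = - (dx j * dx i).
Proof.
by rewrite (grassmann_graded_comm (form_in_dx (in_setT i)) (form_in_dx (in_setT j))) scaleN1r.
Qed.

Lemma dx_sqr i : dx i * dx i = 0.
Proof.
apply/ffunP => S; rewrite mul_dxE ffunE grassmann0E; case: ifP => // iS.
rewrite (_ : _ == _ = false) ?mulr0 //; apply/negP => /eqP/setP/(_ i).
by rewrite !inE eqxx.
Qed.

Lemma one_form_anticomm (a b : 'cV[K]_m) :
  (one_form a : grassmann K m) * one_form b
  = - ((one_form b : grassmann K m) * one_form a).
Proof.
by rewrite (grassmann_graded_comm (form_in_one_form a) (form_in_one_form b)) scaleN1r.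
Qed.

End Monomials.

(** * Substitution of covectors *)

Section OrderedProducts.
Variables (A : nzRingType) (m : nat) (theta : 'I_m -> A).
Hypothesis anticomm : forall i j, theta i * theta j = - (theta j * theta i).
Hypothesis sqr0 : forall i, theta i * theta i = 0.
Implicit Types (S : {set 'I_m}).

Lemma prod_enum_ord S :
  \prod_(j in S) theta j = \prod_(j <- enum 'I_m | j \in S) theta j.
Proof. by rewrite [index_enum _]unlock -enumT. Qed.

Lemma mul_ordered_prod_in i S : i \in S -> theta i * \prod_(j in S) theta j = 0.
Proof.
move=> iS; rewrite prod_enum_ord.
have: i \in enum 'I_m by rewrite mem_enum.
elim: (enum 'I_m) => //= j r IHr; rewrite inE big_cons.
have [<- _|nij] := eqVneq i j; first by rewrite iS mulrA sqr0 mul0r.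
by case: ifP => _ /IHr // IH; rewrite mulrA anticomm mulNr -mulrA IH mulr0 oppr0.
Qed.

(** To reach its place in the increasing product, theta i passes exactly the
    factors of smaller index. *)
Lemma mul_ordered_prod_notin i S : i \notin S ->
  theta i * \prod_(j in S) theta j =
  (-1) ^+ inversions [set i] S * \prod_(j in i |: S) theta j.
Proof.
move=> iS; rewrite inversions1 !prod_enum_ord.
have -> : #|[set j in S | (j < i)%N]| =
    count (fun j : 'I_m => (j \in S) && (j < i)%N) (enum 'I_m).
  rewrite cardE -size_filter /enum_mem -filter_predI; congr size.
  by apply: eq_filter => j; rewrite /= !inE andbT.
have: i \in enum 'I_m by rewrite mem_enum.
have: sorted (fun j k : 'I_m => (j < k)%N) (enum 'I_m).
  by rewrite -(@sorted_map _ _ val ltn) val_enum_ord iota_ltn_sorted.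
elim: (enum 'I_m) => //= j r IHr srt; rewrite inE !big_cons in_setU1.
have srt' := path_sorted srt.
have jr : all (fun k : 'I_m => (j < k)%N) r.
  by apply: order_path_min srt => x y z; apply: ltn_trans.
have [eij _|nij /= ir] := eqVneq i j.
  rewrite -eij (negPf iS) /= add0n (_ : count _ r = 0%N); last first.
    apply/eqP; rewrite -leqn0 leqNgt -has_count; apply/hasPn => k /(allP jr).
    by rewrite eij => ltjk; rewrite negb_and -leqNgt ltnW ?orbT.
  rewrite expr0 mul1r; congr (_ * _); rewrite [LHS]big_seq_cond [RHS]big_seq_cond.
  apply: eq_bigl => k; rewrite in_setU1; case: (boolP (k \in r)) => //= /(allP jr).
  by case: eqP => // ->; rewrite eij ltnn.
rewrite /= (allP jr _ ir) andbT.
case: (boolP (j \in S)) => jS /=; last by rewrite add0n IHr.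
rewrite mulrA anticomm mulNr -mulrA IHr // add1n exprS mulN1r mulNr; congr (- _).
by rewrite !mulrA (commr_sign (theta j)).
Qed.

End OrderedProducts.

Lemma monomial_prod (K : comNzRingType) m (S : {set 'I_m}) :
  monomial K S = \prod_(i in S) dx K i.
Proof.
elim: {S}_.+1 {-2}S (ltnSn #|S|) => // n IHn S ltSn.
have [->|[i iS]] := set_0Vmem S; first by rewrite big_set0.
have iS' : i \notin S :\ i by rewrite !inE eqxx.
have := mul_ordered_prod_notin (@dx_anticomm K m) iS'.
rewrite -(IHn (S :\ i)); last by rewrite (cardsD1 i S) iS in ltSn.
rewrite monomialM ?setD1K // ?disjoints1 //.
rewrite -signr_odd scaler_sign -signr_odd mulr_sign.
by case: odd => // /oppr_inj.
Qed.

Section Substitution.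
Variables (K : comNzRingType) (m : nat) (B : algType K) (theta : 'I_m -> B).
Implicit Types (v w : grassmann K m) (S : {set 'I_m}) (c : K).

(** The algebra morphism sending dx^i to theta i; it is one as soon as the
    theta i anticommute and have square 0 ([substM]). *)
Definition subst w : B := \sum_S w S *: \prod_(i in S) theta i.

Fact subst_linear : linear subst.
Proof.
move=> c v w; rewrite scaler_sumr -big_split; apply: eq_bigr => S _.
by rewrite grassmannDE grassmannZE scalerDl scalerA.
Qed.
HB.instance Definition _ := GRing.isLinear.Build K (grassmann K m) B _ subst subst_linear.

Lemma subst_monomial S : subst (monomial K S) = \prod_(i in S) theta i.
Proof.
rewrite /subst (bigD1 S) //= ffunE eqxx scale1r [X in _ + X]big1 ?addr0 // => T /negPf nTS.
by rewrite ffunE nTS scale0r.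
Qed.

Lemma subst1 : subst 1 = 1.
Proof. by rewrite -monomial0 subst_monomial big_set0. Qed.

Lemma subst_dx i : subst (dx K i) = theta i.
Proof. by rewrite subst_monomial big_set1. Qed.

Lemma subst_one_form (a : 'cV[K]_m) : subst (one_form a) = \sum_i a i 0 *: theta i.
Proof.
by rewrite one_formE linear_sum; apply: eq_bigr => i _; rewrite linearZ /= subst_dx.
Qed.

Hypothesis anticomm : forall i j, theta i * theta j = - (theta j * theta i).
Hypothesis sqr0 : forall i, theta i * theta i = 0.

Lemma substM_dx i w : subst (dx K i * w) = theta i * subst w.
Proof.
rewrite [w]grassmann_expand mulr_sumr !linear_sum mulr_sumr; apply: eq_bigr => S _.
rewrite -scalerAr !linearZ /= -scalerAr; congr (_ *: _); rewrite subst_monomial.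
case: (boolP (i \in S)) => iS.
  rewrite mul_ordered_prod_in // [monomial K S]monomial_prod.
  by rewrite (mul_ordered_prod_in (@dx_anticomm K m) (@dx_sqr K m)) ?linear0.
rewrite monomialM ?disjoints1 // linearZ /= subst_monomial mul_ordered_prod_notin //.
by rewrite -signr_odd scaler_sign -signr_odd mulr_sign.
Qed.

(** A monomial is a product of covectors up to sign, so it suffices to multiply by
    one dx^i; there both algebras produce the same sign. *)
Lemma substM v w : subst (v * w) = subst v * subst w.
Proof.
rewrite [v]grassmann_expand mulr_suml !linear_sum mulr_suml; apply: eq_bigr => S _.
rewrite -scalerAl !linearZ /= -scalerAl; congr (_ *: _).
elim: {S}_.+1 {-2}S (ltnSn #|S|) w => // n IHn S ltSn w.
have [->|[i iS]] := set_0Vmem S; first by rewrite monomial0 subst1 !mul1r.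
have iS' : i \notin S :\ i by rewrite !inE eqxx.
have := monomialM K (_ : [disjoint [set i] & S :\ i]).
rewrite disjoints1 setD1K // => /(_ iS') eS.
have {}eS : monomial K S =
    (-1) ^+ inversions [set i] (S :\ i) *: (dx K i * monomial K (S :\ i)).
  by rewrite eS scalerA -expr2 sqrr_sign scale1r.
rewrite eS -scalerAl !linearZ /= -scalerAl -mulrA !substM_dx IHn ?mulrA //.
by rewrite (cardsD1 i S) iS in ltSn.
Qed.

End Substitution.

Lemma eq_subst (K : comNzRingType) m (B : algType K) (h h' : 'I_m -> B) :
  h =1 h' -> subst h =1 subst h'.
Proof.
move=> hh w; apply: eq_bigr => S _; congr (_ *: _).
by apply: eq_bigr => i _; rewrite hh.
Qed.

(** * Two-forms and matrices *)

Section TwoForms.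
Variables (K : comNzRingType) (m : nat).
Implicit Types (B M : 'M[K]_m) (w : grassmann K m).

Lemma two_formE B : two_form B =
  \sum_(i < m) \sum_(j < m | (i < j)%N) B i j *: (dx K i * dx K j) :> grassmann K m.
Proof.
apply/ffunP => S; rewrite grassmann_sumE ffunE; apply: eq_bigr => i _.
rewrite grassmann_sumE big_mkcondr; apply: eq_bigr => j ltij.
rewrite monomialM; last by rewrite disjoints1 inE neq_ltn ltij.
rewrite inversionsE !big_set1 ltnNge (ltnW ltij) expr0 scale1r grassmannZE ffunE.
by case: ifP; rewrite ?mulr1 ?mulr0.
Qed.

(** Summed over all pairs of indices and not only over i < j, the expression is
    covariant: a change of covectors by M replaces B by M B M^T. *)
Definition bilinear_form B : grassmann K m :=
  \sum_i \sum_j B i j *: (dx K i * dx K j).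

Lemma bilinear_form_two_form B : B^T = - B ->
  bilinear_form B = (two_form B : grassmann K m) *+ 2.
Proof.
move=> antiB; have antiBE i j : B j i = - B i j by move/matrixP/(_ i j): antiB; rewrite !mxE.
have flip : (two_form B : grassmann K m) =
    \sum_(i < m) \sum_(j < m | (j < i)%N) B j i *: (dx K j * dx K i).
  by rewrite two_formE (exchange_big_dep xpredT).
rewrite mulr2n {1}two_formE flip -big_split; apply: eq_bigr => i _ /=.
rewrite [X in _ = X + _]big_mkcond [X in _ = _ + X]big_mkcond -big_split /=.
apply: eq_bigr => j _ /=.
case: (ltngtP i j) => [ij|ji|/val_inj <-]; rewrite ?addr0 ?add0r ?dx_sqr ?scaler0 //.
by rewrite antiBE dx_anticomm scaleNr scalerN opprK.
Qed.

Lemma bilinear_form_mx (p : nat) (M : 'M[K]_(p, m)) B :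
  \sum_i \sum_j B i j *: ((one_form (col i M) : grassmann K p) * one_form (col j M))
  = \sum_k \sum_l (M *m B *m M^T) k l *: (dx K k * dx K l).
Proof.
transitivity (\sum_i \sum_j \sum_k \sum_l (M k i * B i j * M l j) *: (dx K k * dx K l)).
  apply: eq_bigr => i _; apply: eq_bigr => j _; rewrite !one_formE mulr_suml scaler_sumr.
  apply: eq_bigr => k _; rewrite mulr_sumr scaler_sumr; apply: eq_bigr => l _.
  rewrite !mxE -scalerAl -scalerAr !scalerA; congr (_ *: _); ring.
under eq_bigr => i _ do rewrite exchange_big; rewrite exchange_big; apply: eq_bigr => k _ /=.
under eq_bigr => i _ do rewrite exchange_big; rewrite exchange_big; apply: eq_bigr => l _ /=.
rewrite exchange_big mxE scaler_suml; apply: eq_bigr => j _ /=.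
by rewrite !mxE !mulr_suml scaler_suml.
Qed.

Lemma form_in_two_form B : (two_form B : grassmann K m) \in form_in setT 2.
Proof.
rewrite two_formE; apply: rpred_sum => i _; apply: rpred_sum => j _; apply: rpredZ.
by apply: (form_inM (k := 1) (l := 1)); apply: form_in_dx.
Qed.

End TwoForms.

(** * Bidegree as a weight *)

Section SplitCovectors.
Variables (K : comNzRingType) (m : nat) (f g : 'I_m -> grassmann K m).

(** The component of bidegree (p, q) when dx^i = f i + g i is the decomposition
    of dx^i into its (1,0) and (0,1) parts. *)
Definition split_component (p q : nat) (w : grassmann K m) : grassmann K m :=
  \sum_(S : {set 'I_m} | #|S| == (p + q)%N)
  \sum_(A : {set 'I_m} | (A \subset S) && (#|A| == p))
    w S *: \prod_(i in S) (if i \in A then f i else g i).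

(** Distributivity, each factor contributing its scalar c or d. *)
Lemma ordered_prod_split (c d : K) (S : {set 'I_m}) :
  \prod_(i in S) (c *: f i + d *: g i) =
  \sum_(A : {set 'I_m} | A \subset S)
    (c ^+ #|A| * d ^+ (#|S| - #|A|)) *: \prod_(i in S) (if i \in A then f i else g i).
Proof.
(* Indices outside S get the pair (0, 1), so that only A \subset S survives. *)
pose F i := if i \in S then c *: f i else 0.
pose G i := if i \in S then d *: g i else 1.
rewrite big_mkcond; transitivity (\prod_i (F i + G i)).
  by apply: eq_bigr => i _; rewrite /F /G; case: ifP; rewrite ?add0r.
rewrite bigA_distr [RHS]big_mkcond; apply: eq_big => [A|A _]; first by rewrite inE.
case: (boolP (A \subset S)) => [sAS|/subsetPn[i iA iS]]; last first.
  have: i \in enum 'I_m by rewrite mem_enum.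
  rewrite [index_enum _]unlock -enumT; elim: (enum 'I_m) => //= j r IHr.
  rewrite inE big_cons; have [<- _|_ /IHr ->] := eqVneq i j; last by rewrite mulr0.
  by rewrite iA /F (negPf iS) mul0r.
have cS : (#|S| - #|A|)%N = #|S :\: A| by rewrite cardsD (setIidPr sAS).
transitivity (\prod_(i in S) ((if i \in A then c else d) *:
    (if i \in A then f i else g i))).
  rewrite [RHS]big_mkcond; apply: eq_bigr => i _; rewrite /F /G.
  by case: (boolP (i \in A)) => [/(subsetP sAS) -> //|_]; case: ifP.
rewrite scaler_prod; congr (_ *: _); rewrite (big_setID A) /= (setIidPr sAS).
rewrite cS -!prodr_const; congr (_ * _); apply: eq_bigr => i; first by move->.
by rewrite inE => /andP[/negPf ->].
Qed.

(** Substitution is the generating function of the components of all bidegrees. *)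
Lemma subst_split (N : nat) (c d : K) w : (m < N)%N ->
  subst (fun i => c *: f i + d *: g i) w =
  \sum_(p < N) \sum_(q < N) (c ^+ p * d ^+ q) *: split_component p q w.
Proof.
move=> ltN; rewrite /subst.
pose X (S A : {set 'I_m}) (p q : nat) : grassmann K m :=
  if (#|S| == (p + q)%N) && ((A \subset S) && (#|A| == p)) then
    (c ^+ p * d ^+ q) *: (w S *: \prod_(i in S) (if i \in A then f i else g i)) else 0.
transitivity (\sum_(p < N) \sum_(q < N) \sum_S \sum_A X S A p q); last first.
  apply: eq_bigr => p _; apply: eq_bigr => q _; rewrite scaler_sumr [RHS]big_mkcond.
  apply: eq_bigr => S _; rewrite /X; case: ifP => _; last first.
    by rewrite big1.
  by rewrite scaler_sumr [RHS]big_mkcond.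
rewrite pair_bigA /= exchange_big /=; apply: eq_bigr => S _.
rewrite exchange_big /= ordered_prod_split scaler_sumr big_mkcond /=.
apply: eq_bigr => A _.
case: (boolP (A \subset S)) => [sAS|nAS]; last first.
  by rewrite big1 // => pq _; rewrite /X (negPf nAS) andbF.
have leA := subset_leq_card sAS.
have ltS : (#|S| < N)%N by apply: leq_ltn_trans (max_card _) _; rewrite card_ord.
have pP : (#|A| < N)%N by apply: leq_ltn_trans ltS.
have qP : (#|S| - #|A| < N)%N by apply: leq_ltn_trans ltS; apply: leq_subr.
rewrite (bigD1 (Ordinal pP, Ordinal qP)) //= [X in _ + X]big1 ?addr0; last first.
  move=> [p q] /= npq; rewrite /X; case: ifP => // /andP[/eqP eS /andP[_ /eqP eA]].
  case/eqP: npq; congr pair; apply: val_inj => //=.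
  by rewrite eS eA addKn.
by rewrite /X subnKC // !eqxx sAS /= !scalerA mulrC.
Qed.

End SplitCovectors.

Section PureForms.
Variables (K : numFieldType) (m : nat).

Lemma poly_eval_eq0 (N : nat) (c : nat -> K) :
  (forall x, \sum_(p < N) x ^+ p * c p = 0) -> forall p, (p < N)%N -> c p = 0.
Proof.
move=> h p ltp; pose P := \poly_(i < N) c i.
suff P0 : P = 0 by move/polyP/(_ p): P0; rewrite coef_poly ltp coef0.
apply/eqP; apply: contraT => nz.
(* In characteristic 0 the first size P naturals are too many distinct roots. *)
pose rs := [seq i%:R : K | i <- iota 0 (size P)].
have := @max_poly_roots _ P rs nz; rewrite size_map size_iota ltnn; apply.
  apply/allP => _ /mapP[i _ ->]; apply/rootP; rewrite horner_poly.
  by rewrite -[RHS](h i%:R); apply: eq_bigr => j _; rewrite mulrC.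
by rewrite map_inj_uniq ?iota_uniq // => i j /eqP; rewrite eqr_nat => /eqP.
Qed.

Lemma poly2_eval_eq0 (N : nat) (c : nat -> nat -> K) :
  (forall x y, \sum_(p < N) \sum_(q < N) x ^+ p * y ^+ q * c p q = 0) ->
  forall p q, (p < N)%N -> (q < N)%N -> c p q = 0.
Proof.
move=> h p q ltp; move: q; apply: poly_eval_eq0 => y.
move: p ltp; apply: (@poly_eval_eq0 N (fun p => \sum_(q < N) y ^+ q * c p q)) => x.
rewrite -[RHS](h x y); apply: eq_bigr => p _; rewrite mulr_sumr.
by apply: eq_bigr => q _; rewrite mulrA.
Qed.

Section Types.
Variables f g : 'I_m -> grassmann K m.

(** Being of bidegree (p, q), expressed by the generating function of the
    components, from which stability under products is immediate. *)
Definition pure (p q : nat) (w : grassmann K m) : Prop :=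
  forall c d : K, subst (fun i => c *: f i + d *: g i) w = (c ^+ p * d ^+ q) *: w.

(** Two polynomials in c and d that agree at all points of an infinite field have
    the same coefficients. *)
Lemma pure_component p q p' q' w : pure p q w ->
  split_component f g p' q' w = if (p' == p) && (q' == q) then w else 0.
Proof.
move=> pw; (* Large enough for all four exponents and for the generating function. *)
pose N := (m + p + q + p' + q').+1.
apply/eqP; rewrite -subr_eq0; apply/eqP/ffunP => T.
pose u p' q' : grassmann K m :=
  split_component f g p' q' w - (if (p' == p) && (q' == q) then w else 0).
rewrite grassmann0E -/(u p' q').
apply: (@poly2_eval_eq0 N (fun p q => u p q T)); rewrite /N; try lia.
move=> x y; have ltN : (m < N)%N by rewrite /N; lia.
have ltp : (p < N)%N by rewrite /N; lia.
have ltq : (q < N)%N by rewrite /N; lia.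
have : \sum_(p0 < N) \sum_(q0 < N) (x ^+ p0 * y ^+ q0) *: u p0 q0 = 0.
  under eq_bigr => p0 _ do under eq_bigr => q0 _ do rewrite scalerBr.
  under eq_bigr => p0 _ do rewrite sumrB; rewrite sumrB -subst_split // pw.
  apply/eqP; rewrite subr_eq0 eq_sym; apply/eqP.
  rewrite (bigD1 (Ordinal ltp)) //= (bigD1 (Ordinal ltq)) //= !eqxx /=.
  rewrite !big1 ?addr0 //.
    move=> i /negPf nip; rewrite big1 // => j _.
    by rewrite [_ == p]nip scaler0.
  by move=> j /negPf nj; rewrite [_ == q]nj scaler0.
move/ffunP/(_ T); rewrite grassmann_sumE grassmann0E => h0; rewrite -[RHS]h0.
apply: eq_bigr => p0 _; rewrite grassmann_sumE; apply: eq_bigr => q0 _.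
by rewrite grassmannZE.
Qed.

Lemma split_component_linear p q : linear (split_component f g p q).
Proof.
move=> c v w; rewrite /split_component scaler_sumr -big_split; apply: eq_bigr => S _.
rewrite scaler_sumr -big_split; apply: eq_bigr => A _.
by rewrite grassmannDE grassmannZE scalerDl scalerA.
Qed.

Lemma pureZ p q c w : pure p q w -> pure p q (c *: w).
Proof. by move=> pw x y; rewrite linearZ /= pw !scalerA mulrC. Qed.

Lemma pureD p q v w : pure p q v -> pure p q w -> pure p q (v + w).
Proof. by move=> pv pw x y; rewrite linearD /= pv pw scalerDr. Qed.

Lemma pureN p q w : pure p q w -> pure p q (- w).
Proof. by rewrite -scaleN1r; apply: pureZ. Qed.

Lemma pureB p q v w : pure p q v -> pure p q w -> pure p q (v - w).
Proof. by move=> pv pw; apply: pureD => //; apply: pureN. Qed.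

Lemma pure1 : pure 0 0 1.
Proof. by move=> x y; rewrite subst1 !expr0 mulr1 scale1r. Qed.

End Types.

Section PureOneForms.
Variables P Q : 'M[K]_m.
Let f i : grassmann K m := one_form (col i P).
Let g i : grassmann K m := one_form (col i Q).

Lemma mix_one_form c d i : c *: f i + d *: g i = one_form (col i (c *: P + d *: Q)).
Proof.
by rewrite -!one_formZ -one_formD; congr one_form; apply/matrixP => j k; rewrite !mxE.
Qed.

Lemma pureM p q p' q' v w : pure f g p q v -> pure f g p' q' w ->
  pure f g (p + p') (q + q') (v * w).
Proof.
move=> pv pw c d; rewrite substM.
- by rewrite pv pw -scalerAr -scalerAl scalerA !exprD; congr (_ *: _); ring.
- by move=> i j; rewrite !mix_one_form; apply: one_form_anticomm.
- move=> i; rewrite mix_one_form.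
  apply: (form_in_odd_sqr _ (form_in_one_form _)) => //.
  by apply: lregP; rewrite pnatr_eq0.
Qed.

Lemma pureX p q n w : pure f g p q w -> pure f g (n * p) (n * q) (w ^+ n).
Proof.
move=> pw; elim: n => [|n IHn]; first exact: pure1.
by rewrite exprS !mulSn; apply: pureM.
Qed.

Lemma subst_one_form_mx (M : 'M[K]_m) (a : 'cV[K]_m) :
  subst (fun i => one_form (col i M) : grassmann K m) (one_form a) = one_form (M *m a).
Proof.
rewrite subst_one_form one_formE.
under eq_bigr => i _ do rewrite one_formE scaler_sumr.
rewrite exchange_big /=; apply: eq_bigr => j _; rewrite mxE scaler_suml.
by apply: eq_bigr => i _; rewrite !mxE scalerA mulrC.
Qed.

Hypotheses (PQ1 : P + Q = 1%:M) (PQ : P *m Q = 0) (QP : Q *m P = 0).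

Lemma projP : P *m P = P.
Proof. by have := mul1mx P; rewrite -{1}PQ1 mulmxDl QP addr0. Qed.

Lemma projQ : Q *m Q = Q.
Proof. by have := mul1mx Q; rewrite -{1}PQ1 mulmxDl PQ add0r. Qed.

Lemma mix_one_formE c d : (fun i => c *: f i + d *: g i) =1
  fun i => one_form (col i (c *: P + d *: Q)).
Proof. by move=> i; rewrite mix_one_form. Qed.

Lemma pure_one_formP (a : 'cV[K]_m) : pure f g 1 0 (one_form (P *m a)).
Proof.
move=> c d; rewrite (eq_subst (mix_one_formE c d)) subst_one_form_mx mulmxDl -!scalemxAl.
by rewrite !mulmxA projP QP mul0mx scaler0 addr0 one_formZ expr1 expr0 mulr1.
Qed.

Lemma pure_one_formQ (a : 'cV[K]_m) : pure f g 0 1 (one_form (Q *m a)).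
Proof.
move=> c d; rewrite (eq_subst (mix_one_formE c d)) subst_one_form_mx mulmxDl -!scalemxAl.
by rewrite !mulmxA projQ PQ mul0mx scaler0 add0r one_formZ expr1 expr0 mul1r.
Qed.

Lemma one_form_split (a : 'cV[K]_m) :
  one_form a = (one_form (P *m a) : grassmann K m) + one_form (Q *m a).
Proof. by rewrite -one_formD -mulmxDl PQ1 mul1mx. Qed.

(** Under the substitution B becomes M B M^T with M = c P + d Q.  Moving M past B
    exchanges P and Q, and (c P + d Q) (c Q + d P) = c d (P + Q) = c d. *)
Lemma pure_two_form (B : 'M[K]_m) : B^T = - B -> P *m B = B *m Q^T ->
  Q *m B = B *m P^T -> pure f g 1 1 (two_form B).
Proof.
move=> antiB PB QB; have two0 : (2%:R : K) != 0 by rewrite pnatr_eq0.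
have -> : (two_form B : grassmann K m) = 2%:R^-1 *: bilinear_form B.
  by rewrite bilinear_form_two_form // -scaler_nat scalerA mulVf // scale1r.
apply: pureZ => c d.
have anticomm i j : (c *: f i + d *: g i) * (c *: f j + d *: g j) =
   - ((c *: f j + d *: g j) * (c *: f i + d *: g i)).
  by rewrite !mix_one_form one_form_anticomm.
have sqr0 i : (c *: f i + d *: g i) * (c *: f i + d *: g i) = 0.
  rewrite mix_one_form; apply: (form_in_odd_sqr _ (form_in_one_form _)) => //.
  exact: lregP.
transitivity (\sum_i \sum_j B i j *:
   ((one_form (col i (c *: P + d *: Q)) : grassmann K m)
     * one_form (col j (c *: P + d *: Q)))).
  rewrite linear_sum; apply: eq_bigr => i _; rewrite linear_sum; apply: eq_bigr => j _.
  by rewrite linearZ /= substM // !subst_dx !mix_one_form.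
rewrite bilinear_form_mx.
have -> : (c *: P + d *: Q) *m B *m (c *: P + d *: Q)^T = (c * d) *: B.
  rewrite mulmxDl -!scalemxAl PB QB !scalemxAr -mulmxDr -mulmxA.
  have -> : (c *: Q^T + d *: P^T) *m (c *: P + d *: Q)^T
      = ((c *: P + d *: Q) *m (c *: Q + d *: P))^T.
    by rewrite trmx_mul [in RHS]linearD /= !linearZ.
  rewrite mulmxDl !mulmxDr -!scalemxAl -!scalemxAr projP projQ PQ QP.
  rewrite !scaler0 addr0 add0r !scalerA [d * c]mulrC -scalerDr PQ1.
  by rewrite linearZ /= trmx1 -scalemxAr mulmx1.
rewrite !expr1 scaler_sumr; apply: eq_bigr => i _; rewrite scaler_sumr.
by apply: eq_bigr => j _; rewrite mxE scalerA.
Qed.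

End PureOneForms.

End PureForms.

Section ComplexProjections.
Variables (K : numClosedFieldType) (m : nat) (J : 'M[K]_m).

Definition holo_proj : 'M[K]_m := 2^-1 *: (1%:M - 'i *: J).
Definition antiholo_proj : 'M[K]_m := 2^-1 *: (1%:M + 'i *: J).
Local Notation P := holo_proj.
Local Notation Q := antiholo_proj.

Lemma projections_sum : P + Q = 1%:M.
Proof.
rewrite /holo_proj /antiholo_proj -scalerDr addrACA addNr addr0.
rewrite -mulr2n -[1%:M *+ 2]scaler_nat scalerA.
by rewrite mulVf ?scale1r // pnatr_eq0.
Qed.

(** J is skew for the bilinear form B, so the projections onto the two eigenspaces
    of J are exchanged by adjunction. *)
Lemma projections_form_type (B : 'M[K]_m) : J *m B = - (B *m J^T) ->
  P *m B = B *m Q^T /\ Q *m B = B *m P^T.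
Proof.
have QT : Q^T = 2^-1 *: (1%:M + 'i *: J^T).
  by apply/matrixP => i j; rewrite !mxE eq_sym.
have PT : P^T = 2^-1 *: (1%:M - 'i *: J^T).
  by apply/matrixP => i j; rewrite !mxE eq_sym.
move=> JB; rewrite QT PT /holo_proj /antiholo_proj; split.
  rewrite -scalemxAl -scalemxAr.
  by rewrite mulmxBl mulmxDr mul1mx mulmx1 -scalemxAl -scalemxAr JB scalerN opprK.
rewrite -scalemxAl -scalemxAr.
by rewrite mulmxDl mulmxBr mul1mx mulmx1 -scalemxAl -scalemxAr JB scalerN.
Qed.

Hypothesis J_sqr : J *m J = - 1%:M.

Lemma projections_orth : P *m Q = 0 /\ Q *m P = 0.
Proof.
have ii : 'i * 'i = -1 :> K by rewrite -expr2 sqrCi.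
rewrite /holo_proj /antiholo_proj; split; rewrite -scalemxAl -scalemxAr.
  rewrite mulmxBl !mulmxDr !mul1mx mulmx1 -scalemxAl -scalemxAr J_sqr.
  rewrite !scalerN ['i *: ('i *: _)]scalerA ii scaleN1r opprK.
  by rewrite opprD addrA addrK subrr !scaler0.
rewrite mulmxDl !mulmxBr !mul1mx mulmx1 -scalemxAl -scalemxAr J_sqr.
rewrite !scalerN ['i *: ('i *: _)]scalerA ii scaleN1r opprK.
by rewrite addrA subrK subrr !scaler0.
Qed.

End ComplexProjections.

(** * Powers of a nondegenerate 2-form *)

Section Contraction.
Variables (K : numFieldType) (m : nat).
Implicit Types (B : 'M[K]_m) (v w : grassmann K m) (S : {set 'I_m}).

(** Interior product with the j-th coordinate vector field. *)
Definition contract (j : 'I_m) w : grassmann K m :=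
  [ffun S : {set 'I_m} =>
     if j \in S then 0 else (-1) ^+ inversions [set j] S * w (j |: S)].

Fact contract_linear j : linear (contract j).
Proof.
move=> c v w; apply/ffunP => S; rewrite grassmannDE grassmannZE !ffunE.
by case: ifP => _; [rewrite mulr0 addr0|ring].
Qed.
HB.instance Definition _ j := GRing.isLinear.Build K (grassmann K m) (grassmann K m) _
  (contract j) (contract_linear j).

Lemma contract1 j : contract j 1 = 0.
Proof.
apply/ffunP => S; rewrite grassmann0E ffunE; case: ifP => // _; rewrite ffunE.
by rewrite (_ : _ == _ = false) ?mulr0 //; apply/negP => /eqP/setP/(_ j); rewrite !inE eqxx.
Qed.

Lemma inversions_set1 (i j : 'I_m) : inversions [set i] [set j] = (j < i)%N.
Proof. by rewrite inversionsE !big_set1. Qed.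

(** Interior product is an antiderivation with value 1 on dx^i at the vector i and
    0 at the others. *)
Lemma contract_dx i j w :
  contract j (dx K i * w) = (if i == j then w else 0) - dx K i * contract j w.
Proof.
have mulE v S : (dx K i * v) S =
    if i \in S then (-1) ^+ inversions [set i] S * v (S :\ i) else 0.
  by rewrite mul_dxE inversions1.
apply/ffunP => S; rewrite [RHS]grassmannDE [X in _ + X]ffunE ffunE !mulE.
have invD1 k l : k \in S ->
    inversions [set l] S = ((k < l) + inversions [set l] (S :\ k))%N.
  move=> kS; rewrite -{1}(setD1K kS) inversions_Ur ?inversions_set1 //.
  by rewrite disjoints1 !inE eqxx.
case: (boolP (j \in S)) => jS.
  have [->|nij] := eqVneq i j.
    rewrite jS ffunE !inE eqxx /= setD1K // (invD1 j j jS) ltnn add0n.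
    by rewrite mulrA -expr2 sqrr_sign mul1r subrr.
  rewrite grassmann0E add0r; case: ifP => _; last by rewrite oppr0.
  by rewrite ffunE !inE eq_sym nij jS mulr0 oppr0.
rewrite in_setU1; have [->|nij] := eqVneq i j.
  rewrite (negPf jS) subr0 /= inversions_Ur ?disjoints1 // inversions_set1 ltnn add0n.
  by rewrite mulrA -expr2 sqrr_sign mul1r setU1K.
rewrite grassmann0E add0r /=; case: (boolP (i \in S)) => iS; last by rewrite mulr0 oppr0.
rewrite ffunE !inE (negPf jS) andbF (invD1 i j iS) inversions_Ur ?disjoints1 //.
rewrite inversions_set1 (_ : (j |: S) :\ i = j |: S :\ i); last first.
  by apply/setP => k; rewrite !inE; case: eqP => // ->; rewrite (negPf nij).
rewrite (invD1 i i iS) ltnn add0n !exprD; have [_|_|/val_inj eij] := ltngtP i j.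
- by rewrite /=; ring.
- by rewrite /=; ring.
- by rewrite eij eqxx in nij.
Qed.

(** The antiderivation rule, for a factor of even degree whose contraction with the
    j-th vector is the j-th row of B. *)
Lemma contract_two_form B j w : B^T = - B ->
  contract j ((two_form B : grassmann K m) * w) =
  (one_form (row j B)^T : grassmann K m) * w + (two_form B : grassmann K m) * contract j w.
Proof.
move=> antiB; have antiBE k l : B l k = - B k l by move/matrixP/(_ k l): antiB; rewrite !mxE.
have two0 : (2%:R : K) != 0 by rewrite pnatr_eq0.
(* The two indices of each term contribute equally, by antisymmetry. *)
have half : (two_form B : grassmann K m) = 2%:R^-1 *: bilinear_form B.
  by rewrite bilinear_form_two_form // -scaler_nat scalerA mulVf // scale1r.
rewrite half -!scalerAl linearZ /=.
have -> : contract j (bilinear_form B * w) =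
    (one_form (row j B)^T : grassmann K m) * w *+ 2 + bilinear_form B * contract j w.
  rewrite /bilinear_form mulr_suml linear_sum /=.
  transitivity (\sum_i \sum_k (B i k *: (if i == j then dx K k * w else 0)
      - B i k *: (if k == j then dx K i * w else 0)
      + B i k *: (dx K i * dx K k * contract j w))).
    apply: eq_bigr => i _; rewrite mulr_suml linear_sum; apply: eq_bigr => k _ /=.
    rewrite -scalerAl linearZ /= -[dx K i * dx K k * w]mulrA !contract_dx.
    rewrite mulrBr opprB mulrA addrA addrAC !(scalerDr, scalerN).
    by congr (_ - _ + _); case: ifP; rewrite ?mulr0.
  under [LHS]eq_bigr => i _ do rewrite big_split /= sumrB.
  rewrite big_split sumrB /=; congr (_ + _); last first.
    by rewrite mulr_suml; apply: eq_bigr => i _; rewrite mulr_suml;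
       apply: eq_bigr => k _; rewrite -scalerAl.
  rewrite (bigD1 j) //= [X in _ + X - _]big1 ?addr0; last first.
    by move=> i /negPf nij; rewrite big1 // => k _; rewrite nij scaler0.
  rewrite [X in _ - X]exchange_big [X in _ - X](bigD1 j) //=.
  rewrite [X in _ - (_ + X)]big1 ?addr0; last first.
    by move=> i /negPf nij; rewrite big1 // => k _; rewrite nij scaler0.
  rewrite eqxx -sumrB one_formE mulr_suml mulr2n -big_split; apply: eq_bigr => k _ /=.
  by rewrite (antiBE j k) scaleNr opprK !mxE -scalerAl.
by rewrite scalerDr -scaler_nat scalerA mulVf // scale1r.
Qed.

Lemma contract_two_form_exp B j k : B^T = - B ->
  contract j ((two_form B : grassmann K m) ^+ k.+1) =
  ((one_form (row j B)^T : grassmann K m) * (two_form B : grassmann K m) ^+ k) *+ k.+1.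
Proof.
move=> antiB; elim: k => [|k IHk].
  have := contract_two_form j 1 antiB.
  by rewrite contract1 mulr0 addr0 !mulr1 expr1 mulr1n.
rewrite exprS (contract_two_form j _ antiB) // IHk mulrnAr mulrA.
rewrite (form_in_even_comm _ (form_in_two_form B)) // -mulrA -exprS.
by rewrite [RHS]mulrS.
Qed.

(** If i is not in S, the coefficient of dx^i w at S with i added is, up to sign,
    the coefficient of w at S. *)
Lemma dx_annihilates_top w k : w \in form_in setT k -> (k < m)%N ->
  (forall i, dx K i * w = 0) -> w = 0.
Proof.
move=> /form_inP hw ltkm h; apply/ffunP => S; rewrite grassmann0E.
have [//|wS] := eqVneq (w S) 0; have [_ cS] := hw _ wS.
have /subsetPn[i _ iS] : ~~ ([set: 'I_m] \subset S).
  by apply/negP => /subset_leq_card; rewrite cardsT card_ord cS leqNgt ltkm.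
have /ffunP/(_ (i |: S)) := h i; rewrite mul_dxE grassmann0E setU11 => /eqP.
by rewrite mulf_eq0 signr_eq0 /= setU1K // => /eqP.
Qed.

(** Let k + 1 be the first exponent with vanishing power.  Contracting that power
    with the j-th vector gives (k + 1) times the j-th row of B times the k-th
    power.  The rows of B span all covectors, so the k-th power is killed by every
    covector although it is nonzero: it is of top degree 2 k = m = 2 n. *)
Lemma two_form_nondegenerate B n : B^T = - B -> B \in unitmx -> m = (2 * n)%N ->
  (two_form B : grassmann K m) ^+ n != 0.
Proof.
move=> antiB uB em; apply/negP => Bn0.
have ex : exists k, (two_form B : grassmann K m) ^+ k == 0 by exists n.
case: (ex_minnP ex) => -[|k] /eqP k0 kmin; first by move/eqP: k0; rewrite oner_eq0.
have ltkn := kmin _ Bn0; have nz : (two_form B : grassmann K m) ^+ k != 0.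
  by apply/negP => /kmin; rewrite ltnn.
case/eqP: nz; apply: (@dx_annihilates_top _ (k * 2)).
- exact: form_inX (form_in_two_form B).
- by rewrite em; lia.
have rows j : (one_form (row j B)^T : grassmann K m) * (two_form B : grassmann K m) ^+ k = 0.
  have := contract_two_form_exp j k antiB; rewrite k0 linear0 -scaler_nat => /esym/eqP.
  by rewrite scaler_eq0 pnatr_eq0 => /eqP.
move=> i; have -> : dx K i = \sum_j invmx B i j *: (one_form (row j B)^T : grassmann K m).
  transitivity (\sum_l (invmx B *m B) i l *: dx K l).
    rewrite mulVmx // (bigD1 i) //= mxE eqxx scale1r big1 ?addr0 // => l /negPf nl.
    by rewrite mxE eq_sym nl scale0r.
  under [RHS]eq_bigr => j _ do rewrite one_formE scaler_sumr.
  rewrite [RHS]exchange_big /=; apply: eq_bigr => l _; rewrite mxE scaler_suml.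
  by apply: eq_bigr => j _; rewrite !mxE scalerA.
by rewrite mulr_suml big1 // => j _; rewrite -scalerAl rows scaler0.
Qed.

End Contraction.

(** * Forms pulled back along an inclusion of coordinates *)

Section Pullback.
Variables (k m : nat) (sigma : 'I_k -> 'I_m).
Hypothesis sigma_mono : forall i j, (sigma i < sigma j)%N = (i < j)%N.

Let D : {set 'I_m} := [set sigma i | i : 'I_k].

Lemma sigma_inj : injective sigma.
Proof.
move=> i j eij; apply: val_inj; apply/eqP; rewrite eqn_leq leqNgt -sigma_mono eij ltnn.
by rewrite leqNgt -sigma_mono eij ltnn.
Qed.

Lemma imset_sigma_preim (S : {set 'I_m}) : S \subset D ->
  S = (sigma @: [set i | sigma i \in S]).
Proof.
move=> sSD; apply/setP => a; apply/idP/imsetP => [aS|]; last by case=> i; rewrite inE => iS ->.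
by have /imsetP[i _ ei] := subsetP sSD _ aS; exists i => //; rewrite inE -ei.
Qed.

Lemma notin_range (S : {set 'I_m}) a : a \in S -> S :\ a \subset D ->
  ~~ (S \subset D) -> a \notin D.
Proof.
by move=> aS sD; apply: contra => aD; rewrite -(setD1K aS) subUset sub1set aD.
Qed.

Lemma preim_sigmaD1 (S : {set 'I_m}) i :
  [set j | sigma j \in S :\ sigma i] = [set j | sigma j \in S] :\ i.
Proof. by apply/setP => j; rewrite !inE (inj_eq sigma_inj). Qed.

Lemma card_preim_lt (S : {set 'I_m}) i : S \subset D ->
  #|[set j in S | (j < sigma i)%N]| = #|[set j in [set j | sigma j \in S] | (j < i)%N]|.
Proof.
move=> sSD; rewrite -(card_imset _ sigma_inj); apply: eq_card => a; rewrite inE.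
apply/andP/imsetP => [[aS lta]|[j]].
  have /imsetP[j _ ej] := subsetP sSD _ aS.
  by exists j => //; rewrite !inE -ej aS -sigma_mono -ej.
by rewrite !inE => /andP[jS ltji] ->; rewrite sigma_mono.
Qed.

Section Algebra.
Variable K : comNzRingType.

Definition pullback (w : grassmann K k) : grassmann K m :=
  [ffun S : {set 'I_m} => if S \subset D then w [set i | sigma i \in S] else 0].

Definition incl_mx : 'M[K]_(m, k) := \matrix_(a, i) (a == sigma i)%:R.

Fact pullback_linear : linear pullback.
Proof.
move=> c v w; apply/ffunP => S; rewrite grassmannDE grassmannZE !ffunE.
by case: ifP => _; rewrite ?mulr0 ?addr0 // grassmannDE grassmannZE.
Qed.
HB.instance Definition _ :=
  GRing.isLinear.Build K (grassmann K k) (grassmann K m) _ pullback pullback_linear.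

Lemma pullback_monomial S : pullback (monomial K S) = monomial K (sigma @: S).
Proof.
apply/ffunP => T; rewrite !ffunE; case: (boolP (T \subset D)) => [sTD|nTD].
  congr (_%:R); congr nat_of_bool; apply/eqP/eqP => [<-|-> ].
    apply/setP => a; apply/idP/imsetP => [aT|]; last by case=> i; rewrite inE => iS ->.
    have /imsetP[i _ ei] := subsetP sTD _ aT.
    by exists i => //; rewrite inE -ei.
  by apply/setP => i; rewrite inE mem_imset //; apply: sigma_inj.
case: eqP => // eT; case/negP: nTD; rewrite eT; apply: imsetS.
by apply/subsetP => i _; rewrite inE.
Qed.

Lemma one_form_incl (a : 'cV[K]_k) :
  one_form (incl_mx *m a) = \sum_i a i 0 *: dx K (sigma i) :> grassmann K m.
Proof.
rewrite one_formE; under eq_bigr => b _ do rewrite mxE scaler_suml.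
rewrite exchange_big /=; apply: eq_bigr => i _.
rewrite (bigD1 (sigma i)) //= mxE eqxx mul1r big1 ?addr0 // => b /negPf nb.
by rewrite mxE nb mul0r scale0r.
Qed.

Lemma pullback_one_form (a : 'cV[K]_k) :
  pullback (one_form a) = one_form (incl_mx *m a).
Proof.
rewrite one_form_incl one_formE linear_sum; apply: eq_bigr => i _.
by rewrite linearZ /= pullback_monomial imset_set1.
Qed.

(** An increasing map of indices preserves the order of the two indices of every
    monomial, so no sign appears. *)
Lemma pullback_two_form (B : 'M[K]_k) :
  pullback (two_form B) = two_form (incl_mx *m B *m incl_mx^T).
Proof.
transitivity (\sum_(i < k) \sum_(j < k | (i < j)%N) B i j *: (dx K (sigma i) * dx K (sigma j))).
  rewrite two_formE linear_sum; apply: eq_bigr => i _; rewrite linear_sum.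
  apply: eq_bigr => j ltij; rewrite linearZ /=; congr (_ *: _).
  have mono2 l (p q : 'I_l) : (p < q)%N -> dx K p * dx K q = monomial K [set p; q].
    move=> ltpq; rewrite monomialM; last by rewrite disjoints1 inE neq_ltn ltpq.
    by rewrite inversions_set1 ltnNge (ltnW ltpq) expr0 scale1r.
  by rewrite !mono2 ?sigma_mono // pullback_monomial imsetU1 imset_set1.
rewrite two_formE; symmetry.
transitivity (\sum_(a < m) \sum_(b < m | (a < b)%N) \sum_i \sum_j
    ((a == sigma i)%:R * B i j * (b == sigma j)%:R) *: (dx K a * dx K b)).
  apply: eq_bigr => a _; apply: eq_bigr => b _; rewrite mxE exchange_big scaler_suml /=.
  apply: eq_bigr => j _; rewrite !mxE mulr_suml scaler_suml; apply: eq_bigr => i _.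
  by rewrite !mxE.
under eq_bigr => a _ do rewrite exchange_big /=.
rewrite exchange_big /=; apply: eq_bigr => i _.
rewrite (bigD1 (sigma i)) //= [X in _ + X]big1 ?addr0; last first.
  move=> a /negPf na; rewrite big1 // => b _; rewrite big1 // => j _.
  by rewrite na !mul0r scale0r.
rewrite exchange_big /= [RHS]big_mkcond; apply: eq_bigr => j _.
rewrite -sigma_mono; case: ifP => ltij; last first.
  rewrite big1 // => b ltb; rewrite (_ : b == sigma j = false) ?mulr0 ?scale0r //.
  by apply/negP => /eqP eb; rewrite eb ltij in ltb.
rewrite (bigD1 (sigma j)) //= big1 ?addr0; first by rewrite !eqxx mul1r mulr1.
by move=> b /andP[_ /negPf nb]; rewrite nb mulr0 scale0r.
Qed.

Lemma form_in_pullback_one_form (a : 'cV[K]_k) :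
  pullback (one_form a) \in form_in D 1.
Proof.
rewrite pullback_one_form one_form_incl rpred_sum // => i _.
by rewrite rpredZ // form_in_dx // imset_f.
Qed.

Lemma form_in_pullback_two_form (B : 'M[K]_k) :
  pullback (two_form B) \in form_in D 2.
Proof.
rewrite two_formE linear_sum rpred_sum // => i _; rewrite linear_sum rpred_sum // => j ltij.
rewrite linearZ rpredZ //= monomialM; last by rewrite disjoints1 inE neq_ltn ltij.
rewrite linearZ rpredZ //= pullback_monomial imsetU1 imset_set1.
suff : monomial K [set sigma i; sigma j] \in form_in D #|[set sigma i; sigma j]|.
  by rewrite cards2 (inj_eq sigma_inj) neq_ltn ltij.
apply: form_in_monomial; apply/subsetP => a; rewrite !inE.
by case/orP => /eqP ->; rewrite imset_f.
Qed.

End Algebra.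
End Pullback.

(** * Powers of a sum of two commuting nilpotents *)

Section TwoCommutingNilpotents.
Variables (K : numFieldType) (A : algType K) (f1 f2 : A) (n1 n2 : nat).
Hypotheses (f12 : GRing.comm f1 f2) (f1_nil : f1 ^+ n1.+1 = 0) (f2_nil : f2 ^+ n2.+1 = 0).
Local Notation F := (f1 + f2).
Local Notation top := (f1 ^+ n1 * f2 ^+ n2).

Lemma nilpotent_exp_gt (f : A) k l : f ^+ k.+1 = 0 -> (k < l)%N -> f ^+ l = 0.
Proof. by move=> fk ltkl; rewrite -(subnK ltkl) exprD fk mulr0. Qed.

(** The binomial formula in the order that puts the exponent i on f1. *)
Lemma expand_sum_exp p q M : f1 ^+ p * f2 ^+ q * F ^+ M =
  \sum_(i < M.+1) (f1 ^+ (p + i) * f2 ^+ (q + (M - i))) *+ 'C(M, i).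
Proof.
rewrite addrC exprDn_comm; last exact: commr_sym.
rewrite mulr_sumr; apply: eq_bigr => i _; rewrite mulrnAr; congr (_ *+ _).
have f12X k l : f2 ^+ k * f1 ^+ l = f1 ^+ l * f2 ^+ k.
  by apply/commrX/commr_sym/commrX.
by rewrite f12X -mulrA [f2 ^+ q * _]mulrA f12X !exprD !mulrA.
Qed.

(** In each term of the expansion f1 or f2 has an exponent that is too large. *)
Lemma nilpotent_sum_exp0 p q M : (n1 + n2 < p + q + M)%N ->
  f1 ^+ p * f2 ^+ q * F ^+ M = 0.
Proof.
move=> lt; rewrite expand_sum_exp big1 // => i _.
have lei : (i <= M)%N by rewrite -ltnS.
have [gt1|le1] := ltnP n1 (p + i); first by rewrite (nilpotent_exp_gt f1_nil gt1) mul0r mul0rn.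
by rewrite (nilpotent_exp_gt f2_nil) ?mulr0 ?mul0rn //; lia.
Qed.

(** Only the term with exponents (n1, n2) survives. *)
Lemma nilpotent_sum_exp p q M : (p + q + M = n1 + n2)%N -> (p <= n1)%N ->
  f1 ^+ p * f2 ^+ q * F ^+ M = top *+ 'C(M, n1 - p).
Proof.
move=> eM lep; rewrite expand_sum_exp.
have zero (i : nat) : (i <= M)%N -> i != (n1 - p)%N ->
    f1 ^+ (p + i) * f2 ^+ (q + (M - i)) = 0.
  move=> lei ni; have [gt1|le1] := ltnP n1 (p + i).
    by rewrite (nilpotent_exp_gt f1_nil gt1) mul0r.
  rewrite (nilpotent_exp_gt f2_nil) ?mulr0 //; lia.
have [ltM|leM] := ltnP M (n1 - p).
  rewrite bin_small // mulr0n big1 // => i _; rewrite zero ?mul0rn //; last first.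
    by apply/eqP => ei; have := ltn_ord i; lia.
  by rewrite -ltnS.
have lt : (n1 - p < M.+1)%N by [].
rewrite (bigD1 (Ordinal lt)) //= big1 ?addr0 => [|i ni].
  by congr (_ ^+ _ * _ ^+ _ *+ _); lia.
by rewrite zero ?mul0rn // -ltnS.
Qed.

(** The form to which del delbar Omega is proportional. *)
Definition quadric (a b : K) : A :=
  f1 ^+ 2 + (2%:R * a) *: (f1 * f2) + (a ^+ 2 + b ^+ 2) *: f2 ^+ 2.

(** With c the imaginary unit, the two brackets are the differentials of the
    (0,1)-parts of the two characteristic 1-forms. *)
Lemma quadric_split (a b c : K) : b != 0 ->
  f1 * (2%:R^-1 *: (f2 + c *: (b^-1 *: f1 + (a / b) *: f2)))
  - 2%:R^-1 *: (f1 + c *: (- (a / b) *: f1 - ((a ^+ 2 + b ^+ 2) / b) *: f2)) * f2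
  = (c / (2%:R * b)) *: quadric a b.
Proof.
move=> b0; have two0 : (2%:R : K) != 0 by rewrite pnatr_eq0.
have lin x y : 2%:R^-1 *: (x + c *: y) = 2%:R^-1 *: x + (2%:R^-1 * c) *: y :> A.
  by rewrite scalerDr scalerA.
rewrite !lin mulrDr mulrDl -!scalerAr -!scalerAl mulrDr mulrBl -!scalerAr -!scalerAl.
rewrite /quadric !scalerDr !scalerN !scalerA -!expr2.
set x := f1 ^+ 2; set y := f1 * f2; set z := f2 ^+ 2.
rewrite opprD addrACA subrr add0r opprB [X in _ + X]addrC -scaleNr addrA.
rewrite -[X in X + _ = _]addrA -scalerDl.
congr (_ *: _ + _ *: _ + _ *: _); field; rewrite ?b0 ?two0 //=.
Qed.

Definition gauduchon_polynomial (a b : K) : K :=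
  n1%:R * (n1%:R - 1) + 2 * a * n1%:R * n2%:R
  + (a ^+ 2 + b ^+ 2) * (n2%:R * (n2%:R - 1)).

Lemma fact_pred2 n : (n`! * (1 < n) = n * n.-1 * (n - 2)`!)%N.
Proof. by case: n => [|[|n]] //=; rewrite ?muln0 // subn2 muln1 !factS mulnA. Qed.

(** Each of the three terms of the quadric contributes one binomial coefficient;
    multiplying by n1! n2! turns these into k! times the three terms of the
    polynomial. *)
Lemma quadric_exp (a b : K) k : (n1 + n2 = k.+2)%N ->
  (n1`! * n2`!)%:R *: (quadric a b * F ^+ k) =
  (k`!%:R * gauduchon_polynomial a b) *: top.
Proof.
move=> eN.
have pred_natr n : n%:R * (n%:R - 1) = (n * n.-1)%:R :> K.
  by case: n => [|n]; rewrite ?mul0r // -[in X in _ * X]natr1 addrK natrM.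
have e11 : (f1 ^+ 2 * F ^+ k) *+ (n1`! * n2`!) = top *+ (k`! * (n1 * n1.-1)).
  have [lt2|ge2] := ltnP n1 2.
    rewrite (nilpotent_exp_gt f1_nil lt2) mul0r mul0rn.
    by case: (n1) lt2 => [|[|]] //; rewrite ?muln0 ?mulr0n.
  have -> : f1 ^+ 2 * F ^+ k = top *+ 'C(k, n1 - 2).
    by rewrite -[f1 ^+ 2]mulr1 -(expr0 f2) nilpotent_sum_exp //; lia.
  rewrite -mulrnA; congr (_ *+ _).
  (* Here k! = 'C(k, n1 - 2) * (n1 - 2)! * n2!, and n1! = n1 (n1 - 1) (n1 - 2)!. *)
have le : (n1 - 2 <= k)%N by lia.
  have -> : k`! = ('C(k, n1 - 2) * ((n1 - 2)`! * (k - (n1 - 2))`!))%N by rewrite bin_fact.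
  have -> : (k - (n1 - 2) = n2)%N by lia.
  by have := fact_pred2 n1; rewrite ge2 muln1 => ->; ring.
have e22 : (f2 ^+ 2 * F ^+ k) *+ (n1`! * n2`!) = top *+ (k`! * (n2 * n2.-1)).
  have [lt2|ge2] := ltnP n2 2.
    rewrite (nilpotent_exp_gt f2_nil lt2) mul0r mul0rn.
    by case: (n2) lt2 => [|[|]] //; rewrite ?muln0 ?mulr0n.
  have -> : f2 ^+ 2 * F ^+ k = top *+ 'C(k, n1 - 0).
    by rewrite -[f2 ^+ 2]mul1r -(expr0 f1) nilpotent_sum_exp //; lia.
  rewrite subn0 -mulrnA; congr (_ *+ _).
  have le : (n1 <= k)%N by lia.
  have -> : k`! = ('C(k, n1) * (n1`! * (k - n1)`!))%N by rewrite bin_fact.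
  have -> : (k - n1 = n2 - 2)%N by lia.
  by have := fact_pred2 n2; rewrite ge2 muln1 => ->; ring.
have e12 : (f1 * f2 * F ^+ k) *+ (n1`! * n2`!) = top *+ (k`! * (n1 * n2)).
  have [n10|n1gt] := posnP n1.
    have f10 : f1 = 0 by have := f1_nil; rewrite n10 expr1.
    by rewrite f10 !mul0r mul0rn n10 mul0n muln0 mulr0n.
  have -> : f1 * f2 * F ^+ k = top *+ 'C(k, n1 - 1).
    by rewrite -{1}[f1]expr1 -{1}[f2]expr1 nilpotent_sum_exp //; lia.
  rewrite -mulrnA; congr (_ *+ _).
  have [n20|n2gt] := posnP n2; first by rewrite n20 bin_small ?mul0n ?muln0 //; lia.
  have le : (n1 - 1 <= k)%N by lia.
  have -> : k`! = ('C(k, n1 - 1) * ((n1 - 1)`! * (k - (n1 - 1))`!))%N by rewrite bin_fact.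
  have -> : (k - (n1 - 1) = n2 - 1)%N by lia.
  rewrite !subn1 -[in n1`!](prednK n1gt) -[in n2`!](prednK n2gt) !factS !prednK //.
  by ring.
have swap u (X : A) : (n1`! * n2`!)%:R *: (u *: X) = u *: (X *+ (n1`! * n2`!)).
  by rewrite -scaler_nat !scalerA mulrC.
rewrite /quadric !mulrDl -!scalerAl !scalerDr !swap scaler_nat e11 e12 e22.
rewrite -!scaler_nat !scalerA -!scalerDl; congr (_ *: _).
by rewrite /gauduchon_polynomial !pred_natr !natrM; ring.
Qed.

Lemma quadric_exp_over (a b : K) k : (n1 + n2 = k.+2)%N ->
  quadric a b * F ^+ k.+1 = 0.
Proof.
move=> eN; rewrite /quadric !mulrDl -!scalerAl.
rewrite -[f1 ^+ 2]mulr1 -{1}(expr0 f2) nilpotent_sum_exp0 ?eN //.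
rewrite -[f2 ^+ 2]mul1r -{1}(expr0 f1) nilpotent_sum_exp0 ?eN //.
rewrite -{1}[f1]expr1 -{1}[f2]expr1 nilpotent_sum_exp0 ?eN //.
by rewrite !scaler0 !addr0.
Qed.

Lemma quadric_exp_eq0 (a b c : K) k (w : A) : (n1 + n2 = k.+2)%N -> c != 0 ->
  top * w != 0 ->
  c *: (quadric a b * F ^+ k * w) = 0 <-> gauduchon_polynomial a b = 0.
Proof.
move=> eN c0 nz; have fact0 n : (n`!%:R : K) != 0 by rewrite pnatr_eq0 -lt0n fact_gt0.
have E : (n1`! * n2`!)%:R *: (quadric a b * F ^+ k * w) =
    (k`!%:R * gauduchon_polynomial a b) *: (top * w).
  by rewrite scalerAl quadric_exp // -scalerAl.
split=> [/eqP|P0].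
  rewrite scaler_eq0 (negPf c0) /= => /eqP Q0; move/eqP: E.
  rewrite Q0 scaler0 eq_sym scaler_eq0 (negPf nz) orbF mulf_eq0 (negPf (fact0 k)).
  by move/eqP.
move/eqP: E; rewrite P0 mulr0 scale0r scaler_eq0 natrM mulf_eq0.
by rewrite !(negPf (fact0 _)) /= => /eqP ->; rewrite scaler0.
Qed.

End TwoCommutingNilpotents.

Lemma exp_add_square_zero (A : nzRingType) (f s : A) n :
  GRing.comm f s -> s * s = 0 -> (f + s) ^+ n.+1 = f ^+ n.+1 + (f ^+ n * s) *+ n.+1.
Proof.
move=> fs ss; elim: n => [|n IHn]; first by rewrite !expr1 expr0 mul1r.
rewrite exprS IHn mulrDl !mulrDr !mulrnAr -exprS.
have fXs k : s * f ^+ k = f ^+ k * s by apply/commrX/commr_sym.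
by rewrite fXs [s * (_ * s)]mulrA fXs -mulrA ss mulr0 mul0rn addr0 mulrA -exprS -addrA -mulrSr.
Qed.

(** * The bidegree of a complex form *)

From mathcomp Require Import all_classical all_reals all_analysis.
Import numFieldNormedType.Exports.

Section Bidegree.
Variables (R : realType) (m : nat) (J : 'M[R]_m).
Local Notation C := (R[i] : numClosedFieldType).
Local Notation JC := (map_mx (real_complex R) J).
Local Notation P := (holo_proj JC).
Local Notation Q := (antiholo_proj JC).
Let f (i : 'I_m) : grassmann C m := one_form (col i P).
Let g (i : 'I_m) : grassmann C m := one_form (col i Q).

(** Forms of bidegree (p, q) for J at one point. *)
Definition of_type (p q : nat) (w : grassmann C m) : Prop := pure f g p q w.

Lemma proj10E : proj10 J = P. Proof. by []. Qed.
Lemma proj01E : proj01 J = Q. Proof. by []. Qed.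

Lemma bidegreeE p q w : bidegree J p q w = split_component f g p q w.
Proof.
apply: eq_bigr => S _; apply: eq_bigr => A _; apply/ffunP => T.
rewrite grassmannZE ffunE; congr (_ * _).
have E (F : 'I_m -> grassmann C m) : \prod_(i in S) F i = \prod_(i <- enum S) F i.
  by rewrite /enum_mem -enumT big_filter prod_enum_ord.
rewrite E; congr (fun_of_fin _ T); apply: eq_bigr => i _.
by rewrite proj10E proj01E /f /g; case: ifP.
Qed.

Lemma bidegree_linear p q : linear (bidegree J p q : grassmann C m -> grassmann C m).
Proof. by move=> c v w; rewrite !bidegreeE split_component_linear. Qed.

Lemma bidegreeD p q (v w : grassmann C m) :
  bidegree J p q (v + w) = (bidegree J p q v : grassmann C m) + bidegree J p q w.
Proof. by have := bidegree_linear p q 1 v w; rewrite !scale1r. Qed.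

Lemma of_type_bidegree p q p' q' w : of_type p q w ->
  bidegree J p' q' w = if (p' == p) && (q' == q) then w else 0 :> grassmann C m.
Proof. by rewrite bidegreeE; apply: pure_component. Qed.

Lemma bidegree_add_other p q p' q' v w : of_type p q v -> of_type p' q' w ->
  (p == p') && (q == q') = false ->
  bidegree J p q (w + v) = v :> grassmann C m.
Proof.
move=> vT wT ne; rewrite bidegreeD (of_type_bidegree _ _ wT) ne.
by rewrite (of_type_bidegree _ _ vT) !eqxx add0r.
Qed.

Lemma of_typeM p q p' q' v w :
  of_type p q v -> of_type p' q' w -> of_type (p + p') (q + q') (v * w).
Proof. exact: pureM. Qed.

Lemma of_typeX p q n w : of_type p q w -> of_type (n * p) (n * q) (w ^+ n).
Proof. exact: pureX. Qed.

Lemma of_typeZ p q c w : of_type p q w -> of_type p q (c *: w).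
Proof. exact: pureZ. Qed.

Lemma of_typeD p q v w : of_type p q v -> of_type p q w -> of_type p q (v + w).
Proof. exact: pureD. Qed.

Lemma of_typeB p q v w : of_type p q v -> of_type p q w -> of_type p q (v - w).
Proof. exact: pureB. Qed.

Hypothesis J_sqr : J *m J = - 1%:M.

Let JC_sqr : JC *m JC = - 1%:M.
Proof. by rewrite -map_mxM J_sqr map_mxN map_mx1. Qed.

Let PQ1 : P + Q = 1%:M.
Proof. exact: projections_sum. Qed.
Let PQ : P *m Q = 0.
Proof. by have [] := projections_orth JC_sqr. Qed.
Let QP : Q *m P = 0.
Proof. by have [] := projections_orth JC_sqr. Qed.

Lemma of_type_one_form10 (a : 'cV[C]_m) : of_type 1 0 (one_form (P *m a)).
Proof. exact: (pure_one_formP (P := P) (Q := Q) PQ1 QP a). Qed.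

Lemma of_type_one_form01 (a : 'cV[C]_m) : of_type 0 1 (one_form (Q *m a)).
Proof. exact: (pure_one_formQ (P := P) (Q := Q) PQ1 PQ a). Qed.

Lemma one_form_types (a : 'cV[C]_m) :
  one_form a = (one_form (P *m a) : grassmann C m) + one_form (Q *m a).
Proof. exact: (one_form_split PQ1 a). Qed.

(** A real 2-form is of type (1,1) when it is invariant under J, which for
    J^2 = -1 means that J is skew for it. *)
Lemma of_type_two_form (B : 'M[R]_m) : B^T = - B -> J *m B = - (B *m J^T) ->
  of_type 1 1 (two_form (map_mx (real_complex R) B)).
Proof.
move=> antiB JB; set BC := map_mx _ B.
have antiBC : BC^T = - BC by rewrite /BC map_trmx antiB map_mxN.
have JBC : JC *m BC = - (BC *m JC^T) by rewrite map_trmx -!map_mxM JB map_mxN.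
have [PB QB] := projections_form_type JBC.
exact: (pure_two_form PQ1 PQ QP antiBC PB QB).
Qed.

End Bidegree.

(** * Exterior derivative *)

Section ComplexPartials.
Variables (R : realType) (m : nat).
Local Notation C := (R[i] : numClosedFieldType).
Local Notation V := 'rV[R]_m.
Implicit Types (f g : V -> C) (x : V) (i : 'I_m) (d e : C).

Lemma complex_ReD d e : complex.Re (d + e) = complex.Re d + complex.Re e.
Proof. by case: d; case: e. Qed.
Lemma complex_ImD d e : complex.Im (d + e) = complex.Im d + complex.Im e.
Proof. by case: d; case: e. Qed.
Lemma complex_ReM d e :
  complex.Re (d * e) = complex.Re d * complex.Re e - complex.Im d * complex.Im e.
Proof. by case: d; case: e. Qed.
Lemma complex_ImM d e :
  complex.Im (d * e) = complex.Re d * complex.Im e + complex.Im d * complex.Re e.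
Proof. by case: d; case: e. Qed.

(** Existence and value of a partial derivative together: the rules of calculus
    need the first, the exterior derivative uses the second. *)
Definition is_cpartial i f x d :=
  is_derive x (delta_mx 0 i : V) (fun y => complex.Re (f y)) (complex.Re d) /\
  is_derive x (delta_mx 0 i : V) (fun y => complex.Im (f y)) (complex.Im d).

Lemma is_cpartial_val i f x d : is_cpartial i f x d -> cpartial i f x = d.
Proof.
by case=> df dg; rewrite /cpartial /partial !derive_val; case: d df dg.
Qed.

Lemma cpartial_near i f g x : (\near x, f x = g x) ->
  cpartial i f x = cpartial i g x.
Proof.
move=> fg; rewrite /cpartial /partial; congr Complex; apply: near_eq_derive;
  by near do congr (_ _).
Unshelve. all: by end_near. Qed.

Lemma is_cpartial_cst i (c : C) x : is_cpartial i (fun=> c) x 0.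
Proof. by split; apply: is_derive_cst. Qed.

Lemma is_cpartialD i f g x d e : is_cpartial i f x d -> is_cpartial i g x e ->
  is_cpartial i (fun y => f y + g y) x (d + e).
Proof.
move=> [fr fi] [gr gi]; split.
  rewrite complex_ReD (_ : (fun y => complex.Re (f y + g y)) =
    (fun y => complex.Re (f y)) + (fun y => complex.Re (g y))); last first.
    by apply/funext => y; rewrite complex_ReD.
  exact: is_deriveD.
rewrite complex_ImD (_ : (fun y => complex.Im (f y + g y)) =
  (fun y => complex.Im (f y)) + (fun y => complex.Im (g y))); last first.
  by apply/funext => y; rewrite complex_ImD.
exact: is_deriveD.
Qed.

Lemma is_cpartialM i f g x d e : is_cpartial i f x d -> is_cpartial i g x e ->
  is_cpartial i (fun y => f y * g y) x (d * g x + f x * e).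
Proof.
move=> [fr fi] [gr gi]; split.
  rewrite (_ : (fun y => complex.Re (f y * g y)) =
    (fun y => complex.Re (f y)) * (fun y => complex.Re (g y)) -
    (fun y => complex.Im (f y)) * (fun y => complex.Im (g y))); last first.
    by apply/funext => y; rewrite complex_ReM.
  apply: is_derive_eq; rewrite complex_ReD !complex_ReM /GRing.scale /=; ring.
rewrite (_ : (fun y => complex.Im (f y * g y)) =
  (fun y => complex.Re (f y)) * (fun y => complex.Im (g y)) +
  (fun y => complex.Im (f y)) * (fun y => complex.Re (g y))); last first.
  by apply/funext => y; rewrite complex_ImM.
apply: is_derive_eq; rewrite complex_ImD !complex_ImM /GRing.scale /=; ring.
Qed.

Lemma is_cpartial_sum i (I : Type) (r : seq I) (P : pred I) (F : I -> V -> C)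
    x (D : I -> C) : (forall k, is_cpartial i (F k) x (D k)) ->
  is_cpartial i (fun y => \sum_(k <- r | P k) F k y) x (\sum_(k <- r | P k) D k).
Proof.
move=> h; elim: r => [|k r IHr].
  rewrite big_nil (_ : (fun y => _) = fun=> 0); first exact: is_cpartial_cst.
  by apply/funext => y; rewrite big_nil.
rewrite big_cons (_ : (fun y => _) = fun y => if P k then
   F k y + \sum_(k <- r | P k) F k y else \sum_(k <- r | P k) F k y).
  by case: ifP => _ //; apply: is_cpartialD.
by apply/funext => y; rewrite big_cons.
Qed.

Implicit Types (v w : V -> grassmann C m).

(** The witness G lists the partial derivatives of the form, so the predicate
    carries both the differentiability of w at x and the value of d w there. *)
Definition has_d w x (dw : grassmann C m) := exists2 G : 'I_m -> grassmann C m,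
  forall i S, is_cpartial i (fun y => w y S) x (G i S) &
  dw = \sum_i dx C i * G i.

Lemma dC_sum w x : dC w x =
  \sum_i dx C i * ([ffun S : {set 'I_m} => cpartial i (fun y => w y S) x] : grassmann C m)
  :> grassmann C m.
Proof.
apply/ffunP => S; rewrite grassmann_sumE ffunE big_mkcond; apply: eq_bigr => i _.
by rewrite mul_dxE ffunE; case: ifP.
Qed.

Lemma has_d_val w x dw : has_d w x dw -> dC w x = dw.
Proof.
case=> G wG ->; rewrite dC_sum; apply: eq_bigr => i _; congr (dx C i * _).
by apply/ffunP => S; rewrite ffunE (is_cpartial_val (wG i S)).
Qed.

Lemma dC_near v w x : (\near x, v x = w x) -> dC v x = dC w x.
Proof.
move=> vw; rewrite !dC_sum; apply: eq_bigr => i _; congr (dx C i * _).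
apply/ffunP => S; rewrite !ffunE; apply: cpartial_near.
by near do congr (fun_of_fin _ S).
Unshelve. all: by end_near. Qed.

Lemma has_d_cst (c : grassmann C m) x : has_d (fun=> c) x 0.
Proof.
exists (fun=> 0); last by rewrite big1 // => i _; rewrite mulr0.
by move=> i S; rewrite grassmann0E; apply: is_cpartial_cst.
Qed.

Lemma has_dD v w x dv dw : has_d v x dv -> has_d w x dw ->
  has_d (fun y => v y + w y) x (dv + dw).
Proof.
move=> [G vG ->] [H wH ->]; exists (fun i => G i + H i).
  move=> i S; rewrite grassmannDE (_ : (fun y => _) = fun y => v y S + w y S).
    exact: is_cpartialD.
  by apply/funext => y; rewrite grassmannDE.
by rewrite -big_split; apply: eq_bigr => i _; rewrite mulrDr.
Qed.

Lemma has_dZ (c : C) w x dw : has_d w x dw -> has_d (fun y => c *: w y) x (c *: dw).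
Proof.
move=> [G wG ->]; exists (fun i => c *: G i).
  move=> i S; rewrite grassmannZE (_ : (fun y => _) = fun y => c * w y S).
    by have := is_cpartialM (is_cpartial_cst i c x) (wG i S); rewrite mul0r add0r.
  by apply/funext => y; rewrite grassmannZE.
by rewrite scaler_sumr; apply: eq_bigr => i _; rewrite scalerAr.
Qed.

Lemma has_dB v w x dv dw : has_d v x dv -> has_d w x dw ->
  has_d (fun y => v y - w y) x (dv - dw).
Proof.
move=> hv /(has_dZ (-1)) hw; have := has_dD hv hw; rewrite scaleN1r.
by under [fun y => _]funext => y do rewrite scaleN1r.
Qed.

(** The Leibniz rule: dx^i passes a form of degree k with the sign (-1)^k. *)
Lemma has_dM (D : {set 'I_m}) k v w x dv dw : v x \in form_in D k ->
  has_d v x dv -> has_d w x dw ->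
  has_d (fun y => v y * w y) x (dv * w x + (-1) ^+ k *: (v x * dw)).
Proof.
move=> vk [G vG ->] [H wH ->]; exists (fun i => G i * w x + v x * H i).
  move=> i S; rewrite grassmannDE !grassmannME -big_split /=.
  rewrite (_ : (fun y => _) = fun y => \sum_(A : {set 'I_m} | A \subset S)
     (-1) ^+ inversions A (S :\: A) * v y A * w y (S :\: A)); last first.
    by apply/funext => y; rewrite grassmannME.
  rewrite (_ : \sum_(_ | _) _ = \sum_(A : {set 'I_m} | A \subset S)
     ((0 * v x A + (-1) ^+ inversions A (S :\: A) * G i A) * w x (S :\: A)
      + ((-1) ^+ inversions A (S :\: A) * v x A) * H i (S :\: A))); last first.
    by apply: eq_bigr => A _; rewrite mul0r add0r.
  apply: is_cpartial_sum => A; apply: is_cpartialM => //.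
  by apply: is_cpartialM => //; apply: is_cpartial_cst.
rewrite mulr_suml mulr_sumr scaler_sumr -big_split; apply: eq_bigr => i _ /=.
rewrite mulrDr mulrA; congr (_ + _); rewrite !mulrA //.
rewrite (grassmann_graded_comm (form_in_dx C (finset.in_setT i)) vk) mul1n.
by rewrite -scalerAl.
Qed.

Lemma has_dM_closed_even (D : {set 'I_m}) k v w x dw : v x \in form_in D k ->
  ~~ odd k -> has_d v x 0 -> has_d w x dw -> has_d (fun y => v y * w y) x (v x * dw).
Proof.
move=> vk ek dv hw; have := has_dM vk dv hw.
by rewrite mul0r add0r -signr_odd (negPf ek) scale1r.
Qed.

Lemma has_dM_closedr (D : {set 'I_m}) k v w x dv : v x \in form_in D k ->
  has_d v x dv -> has_d w x 0 -> has_d (fun y => v y * w y) x (dv * w x).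
Proof. by move=> vk hv dw; have := has_dM vk hv dw; rewrite mulr0 scaler0 addr0. Qed.

Lemma has_dX_closed (D : {set 'I_m}) k w x : w x \in form_in D k -> ~~ odd k ->
  has_d w x 0 -> forall n, has_d (fun y => w y ^+ n) x 0.
Proof.
move=> wk ek hw; elim=> [|n IHn]; first exact: has_d_cst.
have := has_dM_closed_even wk ek hw IHn; rewrite mulr0.
by under [fun y => _]funext => y do rewrite -exprS.
Qed.

End ComplexPartials.

(** * The operators del and delbar on pure forms *)

Section Dolbeault.
Variables (R : realType) (m : nat) (J : 'rV[R]_m -> 'M[R]_m).
Local Notation C := (R[i] : numClosedFieldType).
Variables (U : set 'rV[R]_m) (v w : 'rV[R]_m -> grassmann C m) (p q : nat).
Hypotheses (Uopen : open U) (lep : (p <= m)%N) (leq : (q <= m)%N).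
Hypothesis vw : forall y, U y -> v y = w y.
Hypothesis w_type : forall y, U y -> of_type (J y) p q (w y).

Let bidegree_near x p' q' : U x ->
  dC (fun y => bidegree (J y) p' q' (v y)) x =
  if (p' == p) && (q' == q) then dC w x else 0 :> grassmann C m.
Proof.
move=> Ux; transitivity (dC (fun y => if (p' == p) && (q' == q) then w y else 0) x).
  apply: dC_near; near=> y; have Uy : U y.
    by near: y; apply: open_nbhs_nbhs; split.
  by rewrite vw // (of_type_bidegree _ _ (w_type Uy)).
by case: ifP => // _; apply: has_d_val (has_d_cst _ _).
Unshelve. all: by end_near. Qed.

Let sum_at (F : nat -> nat -> grassmann C m -> grassmann C m) x :
  (forall p q, F p q 0 = 0) -> U x ->
  \sum_(p' < m.+1) \sum_(q' < m.+1)
    F p' q' (dC (fun y => bidegree (J y) p' q' (v y)) x) = F p q (dC w x).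
Proof.
move=> F0 Ux.
under eq_bigr => p' _ do under eq_bigr => q' _ do rewrite bidegree_near //.
rewrite (bigD1 (Ordinal (lep : (p < m.+1)%N))) //=.
rewrite (bigD1 (Ordinal (leq : (q < m.+1)%N))) //= !eqxx /= !big1 ?addr0 //.
  move=> i /negPf ni; rewrite big1 // => j _.
  by rewrite (ni : (i == p :> nat) = false) F0.
by move=> j /negPf nj; rewrite (nj : (j == q :> nat) = false) F0.
Qed.

Let bidegree0 x p' q' : bidegree (J x) p' q' (0 : grassmann C m) = 0 :> grassmann C m.
Proof.
rewrite bidegreeE /split_component big1 // => S _; rewrite big1 // => A _.
by rewrite grassmann0E scale0r.
Qed.

(** A derivative at x sees the form only near x.  There all components of v but
    one vanish identically, so the sum defining del has one nonzero term. *)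
Lemma del_of_type x : U x -> del J v x = bidegree (J x) p.+1 q (dC w x).
Proof.
by move=> Ux; rewrite -(sum_at (F := fun p q => bidegree (J x) p.+1 q)
  (fun _ _ => bidegree0 _ _ _) Ux).
Qed.

Lemma delbar_of_type x : U x -> delbar J v x = bidegree (J x) p q.+1 (dC w x).
Proof.
by move=> Ux; rewrite -(sum_at (F := fun p q => bidegree (J x) p q.+1)
  (fun _ _ => bidegree0 _ _ _) Ux).
Qed.

End Dolbeault.

(** * Complexification and pullback of differential forms *)

Section Complexification.
Variables (R : realType) (m : nat).
Local Notation C := (R[i] : numClosedFieldType).
Implicit Types (v w : grassmann R m).

Definition complexify w : grassmann C m := ext_toC w.

Lemma complexifyD v w : complexify (v + w) = complexify v + complexify w.
Proof. by apply/ffunP => S; rewrite !ffunE rmorphD. Qed.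

Lemma complexifyZ (c : R) w : complexify (c *: w) = real_complex R c *: complexify w.
Proof. by apply/ffunP => S; rewrite !ffunE rmorphM. Qed.

Lemma complexifyM v w : complexify (v * w) = complexify v * complexify w.
Proof.
apply/ffunP => S; rewrite ffunE !grassmannME rmorph_sum; apply: eq_bigr => A _.
by rewrite !ffunE !rmorphM rmorph_sign.
Qed.

Lemma complexify_one_form (a : 'cV[R]_m) :
  complexify (one_form a) = one_form (map_mx (real_complex R) a).
Proof.
apply/ffunP => S; rewrite !ffunE rmorph_sum; apply: eq_bigr => i _.
by rewrite mxE.
Qed.

Lemma complexify_two_form (B : 'M[R]_m) :
  complexify (two_form B) = two_form (map_mx (real_complex R) B).
Proof.
apply/ffunP => S; rewrite !ffunE rmorph_sum; apply: eq_bigr => i _.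
by rewrite rmorph_sum; apply: eq_bigr => j _; rewrite mxE.
Qed.

Lemma form_in_complexify D p w : w \in form_in D p -> complexify w \in form_in D p.
Proof.
move=> /form_inP hw; apply/form_inP => S; rewrite ffunE fmorph_eq0; exact: hw.
Qed.

End Complexification.

Section PullbackDerivative.
Variables (R : realType) (k m : nat) (sigma : 'I_k -> 'I_m).
Hypothesis sigma_mono : forall i j, (sigma i < sigma j)%N = (i < j)%N.
Variable r : 'rV[R]_m -> 'rV[R]_k.
Hypothesis rE : forall y i, r y 0 i = y 0 (sigma i).
Local Notation C := (R[i] : numClosedFieldType).

Let r_line h v x : r (h *: v + x) = h *: r v + r x.
Proof. by apply/rowP => i; rewrite !(mxE, rE). Qed.

Let quotient_restrict (f : 'rV[R]_k -> R) x v :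
  (fun h => h^-1 *: (((f \o r) \o shift x) (h *: v) - (f \o r) x)) =
  (fun h => h^-1 *: ((f \o shift (r x)) (h *: r v) - f (r x))).
Proof. by apply/funext => h /=; rewrite r_line. Qed.

Lemma derive_restrict (f : 'rV[R]_k -> R) x v :
  'D_v (f \o r) x = 'D_(r v) f (r x).
Proof. by rewrite /derive quotient_restrict. Qed.

Lemma derivable_restrict (f : 'rV[R]_k -> R) x v :
  derivable f (r x) (r v) -> derivable (f \o r) x v.
Proof. by rewrite /derivable quotient_restrict. Qed.

Let r_delta i : r (delta_mx 0 (sigma i)) = delta_mx 0 i.
Proof.
apply/rowP => j; rewrite rE !mxE eqxx /=; congr (_%:R).
by rewrite (inj_eq (sigma_inj sigma_mono)).
Qed.

Let r_delta0 a : a \notin [set sigma i | i : 'I_k]%SET -> r (delta_mx 0 a) = 0.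
Proof.
move=> aD; apply/rowP => j; rewrite rE !mxE eqxx /=.
by case: eqP => // ej; case/negP: aD; rewrite -ej imset_f.
Qed.

(** The pulled back coefficients do not vary along the other coordinates, so only
    the partial derivatives of w itself contribute. *)
Lemma has_d_pullback (w : 'rV[R]_k -> grassmann R k) x :
  (forall S i, derivable (fun y => w y S) (r x) (delta_mx 0 i)) ->
  has_d (fun y => complexify (pullback sigma (w (r y)))) x
    (complexify (pullback sigma (dR w (r x)))).
Proof.
move=> dw; set D := [set sigma i | i : 'I_k]%SET.
pose pw S y := pullback sigma (w (r y)) S.
pose pre (S : {set 'I_m}) := [set i | sigma i \in S]%SET.
have pwE S : pw S = if S \subset D then (fun y => w y (pre S)) \o r else cst 0.
  by apply/funext => y; rewrite /pw ffunE -/D; case: ifP.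
have dpw S a : derivable (pw S) x (delta_mx 0 a).
  rewrite pwE; case: ifP => _; last exact: derivable_cst.
  apply: derivable_restrict; have [/imsetP[i _ ->]|/r_delta0 ->] := boolP (a \in D).
    by rewrite r_delta; apply: dw.
  exact: derivable0.
exists (fun a => [ffun S : {set 'I_m} => real_complex R (partial a (pw S) x)]).
  move=> a S; rewrite ffunE; split => /=.
    rewrite (_ : (fun y => _) = pw S); first exact: derivableP.
    by apply/funext => y; rewrite ffunE.
  rewrite (_ : (fun y => _) = cst 0); first exact: is_derive_cst.
  by apply/funext => y; rewrite ffunE.
apply/ffunP => S; rewrite grassmann_sumE !ffunE.
transitivity (\sum_(a in S) real_complex R
   ((-1) ^+ #|[set j in S | (j < a)%N]%SET| * partial a (pw (S :\ a)%SET) x)); last first.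
  rewrite big_mkcond; apply: eq_bigr => a _; rewrite mul_dxE ffunE; case: ifP => // _.
  by rewrite rmorphM rmorph_sign.
rewrite -rmorph_sum; congr (real_complex R _); case: ifP => sSD; last first.
  rewrite big1 // => a aS; rewrite pwE; case: ifP => sD; last first.
    by rewrite /partial derive_cst mulr0.
  rewrite /partial derive_restrict r_delta0 ?derive0 ?mulr0 //.
  by apply: notin_range aS sD _; rewrite sSD.
have inj := sigma_inj sigma_mono.
rewrite [in RHS](imset_sigma_preim sSD) big_imset /=; last by move=> i j _ _; apply: inj.
apply: eq_bigr => i; rewrite inE => iS; rewrite -(imset_sigma_preim sSD).
rewrite (card_preim_lt sigma_mono) //; congr (_ * _).
rewrite pwE (fintype.subset_trans (finset.subsetDl _ _) sSD) /partial derive_restrict r_delta.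
congr ('D_(_) _ _); apply/funext => y; congr (w y _).
by rewrite /pre (preim_sigmaD1 sigma_mono).
Qed.

End PullbackDerivative.

(** * Linear algebra of almost contact metric structures *)

Section ContactAlgebra.
Variables (F : fieldType) (m : nat).
Variables (phi met : 'M[F]_m) (xi : 'rV[F]_m) (eta : 'cV[F]_m).
Hypothesis eta_xi : xi *m eta = 1%:M.
Hypothesis phi_sqr : phi *m phi = - 1%:M + eta *m xi.
Hypothesis phi_met : phi *m met *m phi^T = met - eta *m eta^T.
Hypothesis met_sym : met^T = met.

(** With v = phi xi, phi^2 xi = 0 gives phi v = 0, hence v = eta(v) xi and
    0 = phi v = eta(v) v; so eta(v)^2 = 0. *)
Lemma contact_xi_phi : xi *m phi = 0.
Proof.
set v := xi *m phi; set s := v *m eta.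
have v_phi : v *m phi = 0.
  by rewrite /v -mulmxA phi_sqr mulmxDr mulmxN mulmx1 mulmxA eta_xi mul1mx addNr.
have vE : v = s *m xi.
  have : v *m phi *m phi = 0 by rewrite v_phi mul0mx.
  rewrite -mulmxA phi_sqr mulmxDr mulmxN mulmx1 mulmxA addrC => /eqP.
  by rewrite subr_eq0 => /eqP.
have s_sqr : s *m s = 0.
  have : s *m v = 0 by rewrite /v mulmxA -vE v_phi.
  by rewrite /s mulmxA => ->; rewrite mul0mx.
have s0 : s = 0.
  move: s_sqr; rewrite [s]mx11_scalar -scalar_mxM => /matrixP/(_ 0 0).
  by rewrite !mxE eqxx /= => /eqP; rewrite mulf_eq0 orbb => /eqP ->; rewrite raddf0.
by rewrite vE s0 mul0mx.
Qed.

(** Compare the two ways of computing phi^3. *)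
Lemma contact_phi_eta : phi *m eta = 0.
Proof.
have : phi *m (phi *m phi) = (phi *m phi) *m phi by rewrite mulmxA.
rewrite phi_sqr mulmxDr mulmxDl mulmxN mulNmx mulmx1 mul1mx => /addrI.
rewrite -[in RHS]mulmxA contact_xi_phi mulmx0 => h.
by rewrite -[LHS]mulmx1 -eta_xi !mulmxA -[phi *m eta *m xi]mulmxA h mul0mx.
Qed.

Lemma contact_xi_met : xi *m met = eta^T.
Proof.
have : xi *m (phi *m met *m phi^T) = 0 by rewrite !mulmxA contact_xi_phi !mul0mx.
by rewrite phi_met mulmxBr mulmxA eta_xi mul1mx => /eqP; rewrite subr_eq0 => /eqP.
Qed.

(** Compose the compatibility of the metric with phi on one side and use
    phi^2 = -id + eta (x) xi; the terms in eta and xi die. *)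
Lemma contact_form_antisym : (phi *m met)^T = - (phi *m met).
Proof.
have := congr1 (mulmx phi) phi_met.
rewrite mulmxBr !mulmxA contact_phi_eta mul0mx subr0 phi_sqr !mulmxDl -!mulmxA.
rewrite [xi *m _]mulmxA contact_xi_met -trmx_mul contact_phi_eta trmx0 mulmx0 addr0.
by rewrite mulNmx mul1mx trmx_mul met_sym => <-; rewrite opprK.
Qed.

Lemma contact_phi_form_sym : (phi *m (phi *m met))^T = phi *m (phi *m met).
Proof.
rewrite mulmxA phi_sqr mulmxDl mulNmx mul1mx -mulmxA contact_xi_met.
by rewrite linearD linearN /= trmx_mul trmxK met_sym.
Qed.

End ContactAlgebra.

Section ProductAlgebra.
Variables (F : fieldType) (m1 m2 : nat).
Variables (phi1 met1 : 'M[F]_m1) (xi1 : 'rV[F]_m1) (eta1 : 'cV[F]_m1).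
Variables (phi2 met2 : 'M[F]_m2) (xi2 : 'rV[F]_m2) (eta2 : 'cV[F]_m2).
Variables (a b : F).
Hypothesis b0 : b != 0.

(** The complex structure of the product in block form, for row vectors. *)
Definition product_structure_mx : 'M[F]_(m1 + m2) :=
  block_mx (phi1 - (a / b) *: (eta1 *m xi1)) (b^-1 *: (eta1 *m xi2))
           (- ((a ^+ 2 + b ^+ 2) / b) *: (eta2 *m xi1))
           (phi2 + (a / b) *: (eta2 *m xi2)).
Local Notation J := product_structure_mx.

Lemma lin1_mx_product_structure :
  lin1_mx (fun Z : 'rV[F]_(m1 + m2) =>
      let X := lsubmx Z in let Y := rsubmx Z in
      row_mx
        (X *m phi1 - (a / b * (X *m eta1) 0 0) *: xi1
           - ((a ^+ 2 + b ^+ 2) / b * (Y *m eta2) 0 0) *: xi1)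
        (Y *m phi2 + (b^-1 * (X *m eta1) 0 0) *: xi2 + (a / b * (Y *m eta2) 0 0) *: xi2))
  = J.
Proof.
apply/row_matrixP => i; rewrite [RHS]rowE; apply/rowP => j; rewrite [LHS]mxE [LHS]mxE.
set Z := delta_mx 0 i; rewrite -[in RHS](hsubmxK Z) mul_row_block.
have outer p q c (X : 'rV[F]_p) (e : 'cV[F]_p) (x : 'rV[F]_q) :
    (c * (X *m e) 0 0) *: x = c *: (X *m (e *m x)).
  by rewrite mulmxA [X *m e in RHS]mx11_scalar mul_scalar_mx scalerA.
congr ((row_mx _ _ : 'rV_(m1 + m2)) 0 j); rewrite !outer.
  by rewrite mulmxBr -!scalemxAr scaleNr.
by rewrite mulmxDr -!scalemxAr addrAC addrC.
Qed.

Hypothesis eta_xi1 : xi1 *m eta1 = 1%:M.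
Hypothesis phi_sqr1 : phi1 *m phi1 = - 1%:M + eta1 *m xi1.
Hypothesis phi_met1 : phi1 *m met1 *m phi1^T = met1 - eta1 *m eta1^T.
Hypothesis met_sym1 : met1^T = met1.
Hypothesis eta_xi2 : xi2 *m eta2 = 1%:M.
Hypothesis phi_sqr2 : phi2 *m phi2 = - 1%:M + eta2 *m xi2.
Hypothesis phi_met2 : phi2 *m met2 *m phi2^T = met2 - eta2 *m eta2^T.
Hypothesis met_sym2 : met2^T = met2.

Let phi_eta1 : phi1 *m eta1 = 0. Proof. exact: contact_phi_eta eta_xi1 phi_sqr1. Qed.
Let phi_eta2 : phi2 *m eta2 = 0. Proof. exact: contact_phi_eta eta_xi2 phi_sqr2. Qed.
Let xi_phi1 : xi1 *m phi1 = 0. Proof. exact: contact_xi_phi eta_xi1 phi_sqr1. Qed.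
Let xi_phi2 : xi2 *m phi2 = 0. Proof. exact: contact_xi_phi eta_xi2 phi_sqr2. Qed.

(** J maps the span of the two characteristic 1-forms to itself, with constant
    coefficients. *)
Lemma product_structure_eta1 : J *m col_mx eta1 0 =
  - (a / b) *: col_mx eta1 0 - ((a ^+ 2 + b ^+ 2) / b) *: col_mx 0 eta2.
Proof.
rewrite mul_block_col !mulmx0 !addr0 mulmxBl phi_eta1 -!scalemxAl -!mulmxA eta_xi1.
rewrite !mulmx1 !scale_col_mx !scaler0 opp_col_mx add_col_mx oppr0 add0r !scaleNr.
by rewrite addr0 sub0r.
Qed.

Lemma product_structure_eta2 : J *m col_mx 0 eta2 =
  b^-1 *: col_mx eta1 0 + (a / b) *: col_mx 0 eta2.
Proof.
rewrite mul_block_col !mulmx0 !add0r mulmxDl phi_eta2 -!scalemxAl -!mulmxA eta_xi2.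
by rewrite !mulmx1 !scale_col_mx !scaler0 add_col_mx !add0r addr0.
Qed.

Lemma product_structure_sqr : J *m J = - 1%:M.
Proof.
have ee p q r (e : 'cV[F]_p) (x : 'rV[F]_r) (f : 'cV[F]_r) (y : 'rV[F]_q) :
    x *m f = 1%:M -> (e *m x) *m (f *m y) = e *m y.
  by move=> xf; rewrite -mulmxA [x *m _]mulmxA xf mul1mx.
have pe1 q (y : 'rV[F]_q) : phi1 *m (eta1 *m y) = 0 by rewrite mulmxA phi_eta1 mul0mx.
have pe2 q (y : 'rV[F]_q) : phi2 *m (eta2 *m y) = 0 by rewrite mulmxA phi_eta2 mul0mx.
have xp1 q (e : 'cV[F]_q) : (e *m xi1) *m phi1 = 0 by rewrite -mulmxA xi_phi1 mulmx0.
have xp2 q (e : 'cV[F]_q) : (e *m xi2) *m phi2 = 0 by rewrite -mulmxA xi_phi2 mulmx0.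
have coef : 1 + (a / b) * (a / b) - b^-1 * ((a ^+ 2 + b ^+ 2) / b) = 0 by field.
have cancel p q (E : 'M[F]_(p, q)) :
    E + ((a / b * (a / b)) *: E - (b^-1 * ((a ^+ 2 + b ^+ 2) / b)) *: E) = 0.
  by rewrite -scalerBl -{1}[E]scale1r -scalerDl addrA coef scale0r.
rewrite mulmx_block [1%:M]scalar_mx_block opp_block_mx !oppr0.
rewrite !(mulmxDl, mulmxDr, mulmxN, mulNmx, scaleNr).
rewrite -?(scalemxAl, scalemxAr) ?pe1 ?pe2 ?xp1 ?xp2.
rewrite -?(scalemxAl, scalemxAr) ?(ee _ _ _ _ _ _ _ eta_xi1) ?(ee _ _ _ _ _ _ _ eta_xi2).
rewrite ?xp1 ?xp2 !scaler0 ?oppr0 ?addr0 ?add0r ?opprK.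
rewrite phi_sqr1 phi_sqr2 !scalerA.
congr block_mx.
- by rewrite -2!addrA cancel addr0.
- by rewrite [b^-1 * _]mulrC addNr.
- by rewrite [a / b * _]mulrC subrr.
- by rewrite [(a ^+ 2 + b ^+ 2) / b / b]mulrC addrC -2!addrA cancel addr0.
Qed.

Definition form_mx1 : 'M[F]_(m1 + m2) := block_mx (phi1 *m met1) 0 0 0.
Definition form_mx2 : 'M[F]_(m1 + m2) := block_mx 0 0 0 (phi2 *m met2).

Lemma form_mx1_antisym : form_mx1^T = - form_mx1.
Proof.
rewrite tr_block_mx !trmx0 opp_block_mx !oppr0; congr block_mx.
exact: contact_form_antisym eta_xi1 phi_sqr1 phi_met1 met_sym1.
Qed.

Lemma form_mx2_antisym : form_mx2^T = - form_mx2.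
Proof.
rewrite tr_block_mx !trmx0 opp_block_mx !oppr0; congr block_mx.
exact: contact_form_antisym eta_xi2 phi_sqr2 phi_met2 met_sym2.
Qed.

(** The mixed terms of J contain xi1, which the contact form kills; on the rest J
    is phi1, which is skew for the contact form. *)
Lemma product_structure_form1 : J *m form_mx1 = - (form_mx1 *m J^T).
Proof.
have JB : J *m form_mx1 = block_mx (phi1 *m (phi1 *m met1)) 0 0 0.
  rewrite mulmx_block !mulmx0 !addr0 mulmxBl -!scalemxAl -!mulmxA.
  by rewrite (mulmxA xi1) xi_phi1 mul0mx !mulmx0 !scaler0 subr0.
have -> : form_mx1 *m J^T = (J *m form_mx1^T)^T by rewrite trmx_mul trmxK.
rewrite form_mx1_antisym mulmxN linearN /= opprK JB tr_block_mx !trmx0; congr block_mx.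
by rewrite (contact_phi_form_sym eta_xi1 phi_sqr1 phi_met1 met_sym1).
Qed.

Lemma product_structure_form2 : J *m form_mx2 = - (form_mx2 *m J^T).
Proof.
have JB : J *m form_mx2 = block_mx 0 0 0 (phi2 *m (phi2 *m met2)).
  rewrite mulmx_block !mulmx0 !add0r mulmxDl -!scalemxAl -!mulmxA.
  by rewrite (mulmxA xi2) xi_phi2 mul0mx !mulmx0 !scaler0 addr0.
have -> : form_mx2 *m J^T = (J *m form_mx2^T)^T by rewrite trmx_mul trmxK.
rewrite form_mx2_antisym mulmxN linearN /= opprK JB tr_block_mx !trmx0; congr block_mx.
by rewrite (contact_phi_form_sym eta_xi2 phi_sqr2 phi_met2 met_sym2).
Qed.

End ProductAlgebra.

(** * The structure equations and their consequences *)

Section StructureEquations.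
Variables (R : realType) (m : nat).
Local Notation C := (R[i] : numClosedFieldType).
Local Notation V := 'rV[R]_m.
Variables (J : V -> 'M[R]_m) (U : set V) (D1 D2 : {set 'I_m}).
Variables (f1 f2 e1 e2 : V -> grassmann C m) (a b t : C).
Local Notation F := (fun y => f1 y + f2 y).
Local Notation Omega := (fun y => f1 y + f2 y + t *: (e1 y * e2 y)).
Let i : C := 'i.
Let e1bar y : grassmann C m :=
  2%:R^-1 *: (e1 y + i *: (- (a / b) *: e1 y - ((a ^+ 2 + b ^+ 2) / b) *: e2 y)).
Let e2bar y : grassmann C m :=
  2%:R^-1 *: (e2 y + i *: (b^-1 *: e1 y + (a / b) *: e2 y)).

Hypothesis b0 : b != 0.
Hypothesis Uopen : open U.
Hypothesis f1_form : forall y, U y -> f1 y \in form_in D1 2.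
Hypothesis f2_form : forall y, U y -> f2 y \in form_in D2 2.
Hypothesis e1_form : forall y, U y -> e1 y \in form_in D1 1.
Hypothesis e2_form : forall y, U y -> e2 y \in form_in D2 1.
Hypothesis df1 : forall y, U y -> has_d f1 y 0.
Hypothesis df2 : forall y, U y -> has_d f2 y 0.
Hypothesis de1 : forall y, U y -> has_d e1 y (f1 y).
Hypothesis de2 : forall y, U y -> has_d e2 y (f2 y).
Hypothesis f1_type : forall y, U y -> of_type (J y) 1 1 (f1 y).
Hypothesis f2_type : forall y, U y -> of_type (J y) 1 1 (f2 y).
Hypothesis e1bar_type : forall y, U y -> of_type (J y) 0 1 (e1bar y).
Hypothesis e2bar_type : forall y, U y -> of_type (J y) 0 1 (e2bar y).
Hypothesis e1hol_type : forall y, U y -> of_type (J y) 1 0 (e1 y - e1bar y).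
Hypothesis e2hol_type : forall y, U y -> of_type (J y) 1 0 (e2 y - e2bar y).
Hypothesis Omega_type : forall y, U y -> of_type (J y) 1 1 (Omega y).

Let f1_central y w : U y -> GRing.comm (f1 y) w.
Proof. by move=> Uy; apply: form_in_even_comm (f1_form Uy) _. Qed.

Let f2_central y w : U y -> GRing.comm (f2 y) w.
Proof. by move=> Uy; apply: form_in_even_comm (f2_form Uy) _. Qed.

Let F_central y w : U y -> GRing.comm (F y) w.
Proof.
move=> Uy; apply/commr_sym/commrD; apply: commr_sym.
  exact: f1_central.
exact: f2_central.
Qed.

Let F_form y : U y -> F y \in form_in finset.setT 2.
Proof.
move=> Uy; rewrite rpredD //; apply: form_in_sub (finset.subsetT _) _.
  exact: f1_form.
exact: f2_form.
Qed.

Let dF y : U y -> has_d F y 0.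
Proof. by move=> Uy; have := has_dD (df1 Uy) (df2 Uy); rewrite addr0. Qed.

Let dFX y k : U y -> has_d (fun y => F y ^+ k) y 0.
Proof. by move=> Uy; apply: has_dX_closed (F_form Uy) _ (dF Uy) _. Qed.

Let FX_form y k : U y -> F y ^+ k \in form_in finset.setT (k * 2).
Proof. by move=> Uy; apply: form_inX (F_form Uy). Qed.

Let dFXM y k (w : V -> grassmann C m) dw : U y -> has_d w y dw ->
  has_d (fun y => F y ^+ k * w y) y (F y ^+ k * dw).
Proof.
move=> Uy; apply: has_dM_closed_even (FX_form k Uy) _ (dFX k Uy).
by rewrite oddM andbF.
Qed.

Let FX_type y k : U y -> of_type (J y) k k (F y ^+ k).
Proof.
move=> Uy; have := of_typeX k (of_typeD (f1_type Uy) (f2_type Uy)).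
by rewrite muln1.
Qed.

(** F is central and the square of e1 e2 is 0. *)
Lemma Omega_exp y k : U y -> Omega y ^+ k.+1 =
  F y ^+ k.+1 + (k.+1%:R * t) *: (F y ^+ k * (e1 y * e2 y)).
Proof.
move=> Uy; rewrite exp_add_square_zero; first last.
- have e11 : e1 y * e1 y = 0.
    by apply: form_in_odd_sqr (e1_form Uy) _ => //; apply: lregP; rewrite pnatr_eq0.
  have e21 : e2 y * e1 y = - (e1 y * e2 y).
    by rewrite (grassmann_graded_comm (e2_form Uy) (e1_form Uy)) scaleN1r.
  rewrite -scalerAl -scalerAr -mulrA [e2 y * _]mulrA e21 mulNr !mulrN !mulrA e11.
  by rewrite !mul0r oppr0 !scaler0.
- exact: F_central.
by rewrite -scalerAr -scaler_nat scalerA.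
Qed.

Let dOmegaX y k : U y ->
  has_d (fun y => F y ^+ k.+1 + (k.+1%:R * t) *: (F y ^+ k * (e1 y * e2 y))) y
    ((k.+1%:R * t) *: (F y ^+ k * (f1 y * e2 y - e1 y * f2 y))).
Proof.
move=> Uy; have de12 := has_dM (e1_form Uy) (de1 Uy) (de2 Uy).
have := has_dD (dFX k.+1 Uy) (has_dZ (k.+1%:R * t) (dFXM k Uy de12)).
by rewrite add0r expr1 scaleN1r.
Qed.

Let theta k y := (k.+1%:R * t) *: (F y ^+ k * (f1 y * e2bar y - e1bar y * f2 y)).

Let theta_type k y : U y -> of_type (J y) k.+1 k.+2 (theta k y).
Proof.
move=> Uy; have h1 := of_typeM (f1_type Uy) (e2bar_type Uy).
have h2 := of_typeM (e1bar_type Uy) (f2_type Uy).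
have := of_typeZ (k.+1%:R * t) (of_typeM (FX_type k Uy) (of_typeB h1 h2)).
by rewrite addn2 addn1.
Qed.

Let delbar_OmegaX v k : (k.+1 <= m)%N -> (forall y, U y -> v y = Omega y ^+ k.+1) ->
  forall y, U y -> delbar J v y = theta k y.
Proof.
move=> lekm vO y Uy.
rewrite (delbar_of_type (p := k.+1) (q := k.+1) (w := fun y =>
   F y ^+ k.+1 + (k.+1%:R * t) *: (F y ^+ k * (e1 y * e2 y))) Uopen) //; first last.
- move=> z Uz; rewrite -Omega_exp //.
  by have := of_typeX k.+1 (Omega_type Uz); rewrite muln1.
- by move=> z Uz; rewrite vO // Omega_exp.
rewrite (has_d_val (dOmegaX k Uy)).
pose u := (k.+1%:R * t) *: (F y ^+ k * (f1 y * (e2 y - e2bar y) - (e1 y - e1bar y) * f2 y)).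
have -> : (k.+1%:R * t) *: (F y ^+ k * (f1 y * e2 y - e1 y * f2 y)) = u + theta k y.
  rewrite /u /theta -scalerDr -mulrDr; congr (_ *: (_ * _)).
  by rewrite mulrBr mulrBl addrACA subrK -opprD subrK.
have uT : of_type (J y) k.+2 k.+1 u.
  have h1 := of_typeM (f1_type Uy) (e2hol_type Uy).
  have h2 := of_typeM (e1hol_type Uy) (f2_type Uy).
  have := of_typeZ (k.+1%:R * t) (of_typeM (FX_type k Uy) (of_typeB h1 h2)).
  by rewrite addn2 addn1.
have thT := theta_type k Uy.
by apply: (bidegree_add_other thT uT); rewrite (ltn_eqF (ltnSn _)).
Qed.

Let dtheta k y : U y -> has_d (theta k) y
  ((k.+1%:R * t * (i / (2%:R * b))) *: (quadric (f1 y) (f2 y) a b * F y ^+ k)).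
Proof.
move=> Uy.
have de1bar : has_d e1bar y (2%:R^-1 *:
    (f1 y + i *: (- (a / b) *: f1 y - ((a ^+ 2 + b ^+ 2) / b) *: f2 y))).
  apply: has_dZ; apply: has_dD; first exact: de1.
  by apply: has_dZ; apply: has_dB; apply: has_dZ; [apply: de1|apply: de2].
have de2bar : has_d e2bar y (2%:R^-1 *: (f2 y + i *: (b^-1 *: f1 y + (a / b) *: f2 y))).
  apply: has_dZ; apply: has_dD; first exact: de2.
  by apply: has_dZ; apply: has_dD; apply: has_dZ; [apply: de1|apply: de2].
have d12 := has_dM_closed_even (f1_form Uy) isT (df1 Uy) de2bar.
have e1bar_form : e1bar y \in form_in finset.setT 1.
  have s1 := form_in_sub (finset.subsetT _) (e1_form Uy).
  have s2 := form_in_sub (finset.subsetT _) (e2_form Uy).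
  by apply/rpredZ/rpredD => //; apply/rpredZ/rpredB; apply/rpredZ.
have d21 := has_dM_closedr e1bar_form de1bar (df2 Uy).
have := has_dZ (k.+1%:R * t) (dFXM k Uy (has_dB d12 d21)).
rewrite (quadric_split (f1 y) (f2 y) a i b0) -scalerAr scalerA.
by rewrite (commrX k (commr_sym (F_central _ Uy))).
Qed.

Let quadric_type y : U y -> of_type (J y) 2 2 (quadric (f1 y) (f2 y) a b).
Proof.
move=> Uy; apply: of_typeD; first apply: of_typeD.
- exact: (of_typeX 2 (f1_type Uy)).
- exact/of_typeZ/(of_typeM (f1_type Uy) (f2_type Uy)).
- exact/of_typeZ/(of_typeX 2 (f2_type Uy)).
Qed.

(** d F = 0 and d e1 = f1, d e2 = f2 give d (F^k e1 e2) = F^k (f1 e2 - e1 f2),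
    whose part of type (k+1, k+2) is F^k (f1 e2'' - e1'' f2).  The differentials of
    e1'' and e2'' are combinations of f1 and f2, so the differential of that part
    is already of type (k+2, k+2). *)
Lemma del_delbar_OmegaX v k : (k.+2 <= m)%N -> (forall y, U y -> v y = Omega y ^+ k.+1) ->
  forall y, U y -> del J (delbar J v) y =
    (k.+1%:R * t * (i / (2%:R * b))) *: (quadric (f1 y) (f2 y) a b * F y ^+ k).
Proof.
move=> lekm vO y Uy.
rewrite (del_of_type (p := k.+1) (q := k.+2) (w := theta k) Uopen) //; first last.
- by move=> z Uz; apply: theta_type.
- by move=> z Uz; apply: (delbar_OmegaX _ vO Uz); apply: ltnW.
- exact: ltnW.
rewrite (has_d_val (dtheta k Uy)).
have T := of_typeZ (k.+1%:R * t * (i / (2%:R * b)))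
  (of_typeM (quadric_type Uy) (FX_type k Uy)).
by rewrite (of_type_bidegree _ _ T) !eqxx.
Qed.

End StructureEquations.

(** * Charts of a product and regularity of the contact forms *)

Section ProductCharts.
Variables (R : realType) (m1 m2 : nat) (M1 : atlas R m1) (M2 : atlas R m2).

Lemma chart_image_prod (c : Defs.index (prod_atlas M1 M2)) x :
  chart_image c x <-> chart_image c.1 (lsubmx x) /\ chart_image c.2 (rsubmx x).
Proof.
split=> [[[p1 p2] [/= d1 d2] <-]|[[p1 d1 e1] [p2 d2 e2]]].
  by rewrite row_mxKl row_mxKr; split; [exists p1|exists p2].
by exists (p1, p2) => //=; rewrite e1 e2 hsubmxK.
Qed.

Lemma chart_image_prod_open (hM1 : smooth_manifold M1) (hM2 : smooth_manifold M2)
  (c : Defs.index (prod_atlas M1 M2)) : open (chart_image c).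
Proof.
have -> : chart_image c = (((lsubmx : 'rV[R]_(m1 + m2) -> 'rV_m1) @^-1` chart_image c.1)
    `&` ((rsubmx : 'rV[R]_(m1 + m2) -> 'rV_m2) @^-1` chart_image c.2))%classic.
  by apply/funext => x; apply/propext; exact: chart_image_prod.
apply: openI; apply: open_comp.
- by move=> x _; apply: continuous_lsubmx.
- exact: image_open.
- by move=> x _; apply: continuous_rsubmx.
- exact: image_open.
Qed.

Lemma chart_image_prod_nonempty (hM1 : smooth_manifold M1) (hM2 : smooth_manifold M2) :
  exists (c : Defs.index (prod_atlas M1 M2)) x, chart_image c x.
Proof.
have pt m (M : atlas R m) : smooth_manifold M -> exists (c : Defs.index M) p, dom c p.
  move=> hM; have [p] := manifold_nonempty hM.
  have : (\bigcup_c dom (a := M) c)%classic p by rewrite (dom_cover hM).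
  by case=> c _ dp; exists c, p.
have [c1 [p1 d1]] := pt _ _ hM1; have [c2 [p2 d2]] := pt _ _ hM2.
by exists (c1, c2), (row_mx (chart c1 p1) (chart c2 p2)); exists (p1, p2).
Qed.

End ProductCharts.

Section ContactForms.
Variables (R : realType) (m : nat) (M : atlas R m) (s : contact_data M).
Hypothesis hs : almost_contact_metric s.

Lemma derivable_big (V : normedModType R) (I : Type) (r : seq I) (P : pred I)
    (F : I -> V -> R) x v : (forall k, P k -> derivable (F k) x v) ->
  derivable (fun y => \sum_(k <- r | P k) F k y) x v.
Proof.
move=> h; elim: r => [|k r IHr].
  rewrite (_ : (fun y => _) = cst 0); first exact: derivable_cst.
  by apply/funext => y; rewrite big_nil.
rewrite (_ : (fun y => _) = if P k then F k + (fun y => \sum_(k <- r | P k) F k y)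
    else fun y => \sum_(k <- r | P k) F k y).
  by case: ifP => // /h Fk; exact: (derivableD Fk IHr).
by apply/funext => y; rewrite big_cons; case: ifP.
Qed.

Lemma derivable_eta_form c x S v : chart_image c x ->
  derivable (fun y => eta_form s c y S) x v.
Proof.
move=> cx; rewrite (_ : (fun y => _) =
  fun y => \sum_(i | S == [set i]%SET) Defs.eta s c y i 0).
  apply: derivable_big => i _; apply: diff_derivable.
  by have [/(_ c i 0 [::] x cx)] := eta_field hs.
by apply/funext => y; rewrite ffunE.
Qed.

Lemma derivable_contact_form c x S v : chart_image c x ->
  derivable (fun y => contact_form s c y S) x v.
Proof.
move=> cx; rewrite (_ : (fun y => _) = fun y => \sum_(i : 'I_m)
    \sum_(j : 'I_m | (i < j)%N && (S == [set i; j]%SET))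
      \sum_(l : 'I_m) Defs.phi s c y i l * Defs.met s c y l j).
  apply: derivable_big => i _; apply: derivable_big => j _.
  apply: derivable_big => l _; apply: derivableM; apply: diff_derivable.
    by have [/(_ c i l [::] x cx)] := phi_field hs.
  by have [[/(_ c l j [::] x cx)]] := met_field hs.
apply/funext => y; rewrite ffunE; apply: eq_bigr => i _; apply: eq_bigr => j _.
by rewrite mxE.
Qed.

End ContactForms.

Lemma incl_mx_lshift (K : comNzRingType) m1 m2 :
  incl_mx (@lshift m1 m2) K = col_mx 1%:M 0.
Proof.
apply/matrixP => x j; rewrite -[x]splitK mxE; case: (fintype.split x) => k /=.
  by rewrite col_mxEu mxE (inj_eq (@lshift_inj _ _)).
by rewrite col_mxEd mxE eq_sym eq_lrshift.
Qed.

Lemma incl_mx_rshift (K : comNzRingType) m1 m2 :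
  incl_mx (@rshift m1 m2) K = col_mx 0 1%:M.
Proof.
apply/matrixP => x j; rewrite -[x]splitK mxE; case: (fintype.split x) => k /=.
  by rewrite col_mxEu mxE eq_lrshift.
by rewrite col_mxEd mxE (inj_eq (@rshift_inj _ _)).
Qed.

(** * The lifted forms on the product *)

Section ProductForms.
Variables (R : realType) (m1 m2 : nat) (M1 : atlas R m1) (M2 : atlas R m2).
Variables (s1 : contact_data M1) (s2 : contact_data M2) (a b t : R).
Hypotheses (hM1 : smooth_manifold M1) (hM2 : smooth_manifold M2).
Hypotheses (hs1 : sasakian s1) (hs2 : sasakian s2) (b0 : b != 0).
Variable c : Defs.index (prod_atlas M1 M2).
Local Notation C := (R[i] : numClosedFieldType).
Local Notation V := 'rV[R]_(m1 + m2).
Local Notation toC := (real_complex R).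
Local Notation U := (chart_image c).
Local Notation J := (prod_complex_structure s1 s2 a b c).

Let acm1 : almost_contact_metric s1. Proof. by case: hs1 => -[]. Qed.
Let acm2 : almost_contact_metric s2. Proof. by case: hs2 => -[]. Qed.

Let U1 y : U y -> chart_image c.1 (lsubmx y). Proof. by case/chart_image_prod. Qed.
Let U2 y : U y -> chart_image c.2 (rsubmx y). Proof. by case/chart_image_prod. Qed.

(** The contact and characteristic forms of the factors in the chart c of the
    product, complexified. *)
Definition lifted_contact1 (y : V) : grassmann C (m1 + m2) :=
  complexify (pullback (lshift m2) (contact_form s1 c.1 (lsubmx y))).
Definition lifted_contact2 (y : V) : grassmann C (m1 + m2) :=
  complexify (pullback (@rshift m1 m2) (contact_form s2 c.2 (rsubmx y))).
Definition lifted_eta1 (y : V) : grassmann C (m1 + m2) :=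
  complexify (pullback (lshift m2) (eta_form s1 c.1 (lsubmx y))).
Definition lifted_eta2 (y : V) : grassmann C (m1 + m2) :=
  complexify (pullback (@rshift m1 m2) (eta_form s2 c.2 (rsubmx y))).
Local Notation f1 := lifted_contact1.
Local Notation f2 := lifted_contact2.
Local Notation e1 := lifted_eta1.
Local Notation e2 := lifted_eta2.

Lemma ext_toC_prod_fundamental_form y :
  ext_toC (prod_fundamental_form s1 s2 t c y) =
  f1 y + f2 y + toC t *: (e1 y * e2 y) :> grassmann C (m1 + m2).
Proof.
rewrite -[RHS]/(complexify _ + complexify _ + toC t *: (complexify _ * complexify _)).
by rewrite -complexifyM -complexifyZ -!complexifyD.
Qed.

Let lmono (i j : 'I_m1) : (lshift m2 i < lshift m2 j)%N = (i < j)%N.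
Proof. by []. Qed.
Let rmono (i j : 'I_m2) : (rshift m1 i < rshift m1 j)%N = (i < j)%N.
Proof. by rewrite /= ltn_add2l. Qed.

Lemma lifted_contact1_form y :
  f1 y \in form_in [set lshift m2 i | i : 'I_m1]%SET 2.
Proof. exact/form_in_complexify/form_in_pullback_two_form. Qed.
Lemma lifted_contact2_form y :
  f2 y \in form_in [set rshift m1 i | i : 'I_m2]%SET 2.
Proof. exact/form_in_complexify/(form_in_pullback_two_form rmono). Qed.
Lemma lifted_eta1_form y :
  e1 y \in form_in [set lshift m2 i | i : 'I_m1]%SET 1.
Proof. exact/form_in_complexify/form_in_pullback_one_form. Qed.
Lemma lifted_eta2_form y :
  e2 y \in form_in [set rshift m1 i | i : 'I_m2]%SET 1.
Proof. exact/form_in_complexify/(form_in_pullback_one_form rmono). Qed.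

Let lE (y : V) i : lsubmx y 0 i = y 0 (lshift m2 i). Proof. by rewrite mxE. Qed.
Let rE (y : V) i : rsubmx y 0 i = y 0 (rshift m1 i). Proof. by rewrite mxE. Qed.

Lemma d_lifted_eta1 y : U y -> has_d e1 y (f1 y).
Proof.
move=> /U1 Uy; have [_ deta] := hs1; rewrite /f1 -deta //.
by apply: (has_d_pullback lmono lE) => S i; apply: derivable_eta_form.
Qed.

Lemma d_lifted_eta2 y : U y -> has_d e2 y (f2 y).
Proof.
move=> /U2 Uy; have [_ deta] := hs2; rewrite /f2 -deta //.
by apply: (has_d_pullback rmono rE) => S i; apply: derivable_eta_form.
Qed.

Let complexify_pullback0 k m (sigma : 'I_k -> 'I_m) :
  complexify (pullback sigma (0 : grassmann R k)) = 0.
Proof. by apply/ffunP => S; rewrite !ffunE; case: ifP; rewrite ?ffunE rmorph0. Qed.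

Lemma d_lifted_contact1 y : U y -> has_d f1 y 0.
Proof.
move=> /U1 Uy; have [[_ _ dPhi] _] := hs1.
rewrite -(complexify_pullback0 (lshift m2)) -(dPhi _ _ Uy).
by apply: (has_d_pullback lmono lE) => S i; apply: derivable_contact_form.
Qed.

Lemma d_lifted_contact2 y : U y -> has_d f2 y 0.
Proof.
move=> /U2 Uy; have [[_ _ dPhi] _] := hs2.
rewrite -(complexify_pullback0 (@rshift m1 m2)) -(dPhi _ _ Uy).
by apply: (has_d_pullback rmono rE) => S i; apply: derivable_contact_form.
Qed.

Let phi1 (y : V) := Defs.phi s1 c.1 (lsubmx y).
Let phi2 (y : V) := Defs.phi s2 c.2 (rsubmx y).
Let met1 (y : V) := Defs.met s1 c.1 (lsubmx y).
Let met2 (y : V) := Defs.met s2 c.2 (rsubmx y).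
Let xi1 (y : V) := Defs.xi s1 c.1 (lsubmx y).
Let xi2 (y : V) := Defs.xi s2 c.2 (rsubmx y).
Let eta1 (y : V) := Defs.eta s1 c.1 (lsubmx y).
Let eta2 (y : V) := Defs.eta s2 c.2 (rsubmx y).

Let JE y : J y = product_structure_mx (phi1 y) (xi1 y) (eta1 y) (phi2 y) (xi2 y) (eta2 y) a b.
Proof. exact: lin1_mx_product_structure. Qed.

Let e1E y : e1 y = one_form (map_mx toC (col_mx (eta1 y) 0)).
Proof.
rewrite /e1 /eta_form (pullback_one_form lmono) incl_mx_lshift complexify_one_form.
by rewrite mul_col_mx mul1mx mul0mx.
Qed.

Let e2E y : e2 y = one_form (map_mx toC (col_mx 0 (eta2 y))).
Proof.
rewrite /e2 /eta_form (pullback_one_form rmono) incl_mx_rshift complexify_one_form.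
by rewrite mul_col_mx mul1mx mul0mx.
Qed.

Let f1E y : f1 y = two_form (map_mx toC (form_mx1 m2 (phi1 y) (met1 y))).
Proof.
rewrite /f1 /contact_form (pullback_two_form lmono) incl_mx_lshift complexify_two_form.
rewrite mul_col_mx mul1mx mul0mx tr_col_mx trmx1 trmx0 mul_col_row !mulmx1 !mulmx0.
by [].
Qed.

Let f2E y : f2 y = two_form (map_mx toC (form_mx2 m1 (phi2 y) (met2 y))).
Proof.
rewrite /f2 /contact_form (pullback_two_form rmono) incl_mx_rshift complexify_two_form.
rewrite mul_col_mx mul1mx mul0mx tr_col_mx trmx1 trmx0 mul_col_row !mulmx1 !mulmx0.
by [].
Qed.

Let met1_sym y : U y -> (met1 y)^T = met1 y.
Proof. by move=> /U1 Uy; have [_ /(_ _ _ Uy) []] := met_field acm1. Qed.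
Let met2_sym y : U y -> (met2 y)^T = met2 y.
Proof. by move=> /U2 Uy; have [_ /(_ _ _ Uy) []] := met_field acm2. Qed.

Lemma prod_complex_structure_sqr y : U y -> J y *m J y = - 1%:M.
Proof.
move=> Uy; rewrite JE; exact: (product_structure_sqr a b0 (eta_xi acm1 (U1 Uy))
  (phi_sqr acm1 (U1 Uy)) (eta_xi acm2 (U2 Uy)) (phi_sqr acm2 (U2 Uy))).
Qed.

Lemma lifted_contact1_type y : U y -> of_type (J y) 1 1 (f1 y).
Proof.
move=> Uy; rewrite f1E; apply: of_type_two_form.
- exact: prod_complex_structure_sqr.
- exact: (form_mx1_antisym m2 (eta_xi acm1 (U1 Uy)) (phi_sqr acm1 (U1 Uy))
    (phi_met acm1 (U1 Uy)) (met1_sym Uy)).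
- by rewrite JE; apply: product_structure_form1 (eta_xi acm1 (U1 Uy))
    (phi_sqr acm1 (U1 Uy)) (phi_met acm1 (U1 Uy)) (met1_sym Uy).
Qed.

Lemma lifted_contact2_type y : U y -> of_type (J y) 1 1 (f2 y).
Proof.
move=> Uy; rewrite f2E; apply: of_type_two_form.
- exact: prod_complex_structure_sqr.
- exact: (form_mx2_antisym m1 (eta_xi acm2 (U2 Uy)) (phi_sqr acm2 (U2 Uy))
    (phi_met acm2 (U2 Uy)) (met2_sym Uy)).
- by rewrite JE; apply: product_structure_form2 (eta_xi acm2 (U2 Uy))
    (phi_sqr acm2 (U2 Uy)) (phi_met acm2 (U2 Uy)) (met2_sym Uy).
Qed.

Let antiholo_one_form (K : numClosedFieldType) k (A : 'M[K]_k) (v : 'cV[K]_k) :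
  one_form (antiholo_proj A *m v) =
  2%:R^-1 *: ((one_form v : grassmann K k) + 'i *: (one_form (A *m v) : grassmann K k)).
Proof.
by rewrite /antiholo_proj -scalemxAl one_formZ mulmxDl mul1mx one_formD -scalemxAl one_formZ.
Qed.

Let e1bar_one_form y : U y ->
  2%:R^-1 *: (e1 y + 'i *: (- (toC a / toC b) *: e1 y
    - ((toC a ^+ 2 + toC b ^+ 2) / toC b) *: e2 y)) =
  one_form (antiholo_proj (map_mx toC (J y)) *m map_mx toC (col_mx (eta1 y) 0)).
Proof.
move=> Uy; have JE1 := product_structure_eta1 _ _ _ _ _
  (eta_xi acm1 (U1 Uy)) (phi_sqr acm1 (U1 Uy)).
rewrite antiholo_one_form -map_mxM JE JE1.
rewrite -[- (_ *: col_mx 0 _)]scaleNr map_mxD !map_mxZ one_formD !one_formZ -e1E -e2E.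
by rewrite -[- (_ *: e2 y)]scaleNr !(rmorphN, rmorphM, rmorphD, rmorphXn, fmorphV).
Qed.

Let e2bar_one_form y : U y ->
  2%:R^-1 *: (e2 y + 'i *: ((toC b)^-1 *: e1 y + (toC a / toC b) *: e2 y)) =
  one_form (antiholo_proj (map_mx toC (J y)) *m map_mx toC (col_mx 0 (eta2 y))).
Proof.
move=> Uy; have JE2 := product_structure_eta2 _ _ _ _ _
  (eta_xi acm2 (U2 Uy)) (phi_sqr acm2 (U2 Uy)).
rewrite antiholo_one_form -map_mxM JE JE2.
rewrite map_mxD !map_mxZ one_formD !one_formZ -e1E -e2E.
by rewrite !(rmorphM, fmorphV).
Qed.

Let e1bar_type y : U y -> of_type (J y) 0 1 (2%:R^-1 *: (e1 y + 'i *: (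
    - (toC a / toC b) *: e1 y - ((toC a ^+ 2 + toC b ^+ 2) / toC b) *: e2 y))).
Proof.
move=> Uy; rewrite e1bar_one_form //; apply: of_type_one_form01.
exact: prod_complex_structure_sqr.
Qed.

Let e2bar_type y : U y -> of_type (J y) 0 1 (2%:R^-1 *: (e2 y + 'i *: (
    (toC b)^-1 *: e1 y + (toC a / toC b) *: e2 y))).
Proof.
move=> Uy; rewrite e2bar_one_form //; apply: of_type_one_form01.
exact: prod_complex_structure_sqr.
Qed.

Let e1hol_type y : U y -> of_type (J y) 1 0 (e1 y - 2%:R^-1 *: (e1 y + 'i *: (
    - (toC a / toC b) *: e1 y - ((toC a ^+ 2 + toC b ^+ 2) / toC b) *: e2 y))).
Proof.
move=> Uy; rewrite e1bar_one_form // {1}e1E (one_form_types (J y)) addrK.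
exact/of_type_one_form10/prod_complex_structure_sqr.
Qed.

Let e2hol_type y : U y -> of_type (J y) 1 0 (e2 y - 2%:R^-1 *: (e2 y + 'i *: (
    (toC b)^-1 *: e1 y + (toC a / toC b) *: e2 y))).
Proof.
move=> Uy; rewrite e2bar_one_form // {1}e2E (one_form_types (J y)) addrK.
exact/of_type_one_form10/prod_complex_structure_sqr.
Qed.

Local Notation Omega := (fun y => f1 y + f2 y + toC t *: (e1 y * e2 y)).

Hypothesis Omega_type : forall y, U y -> of_type (J y) 1 1 (Omega y).

Let toCb0 : toC b != 0.
Proof. by rewrite fmorph_eq0. Qed.

Lemma del_delbar_prod_form (v : V -> grassmann C (m1 + m2)) k : (k.+2 <= m1 + m2)%N ->
  (forall y, U y -> v y = Omega y ^+ k.+1) ->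
  forall y, U y -> del (prod_complex_structure s1 s2 a b c)
      (delbar (prod_complex_structure s1 s2 a b c) v) y =
    (k.+1%:R * toC t * ('i / (2%:R * toC b))) *:
      (quadric (f1 y) (f2 y) (toC a) (toC b) * (f1 y + f2 y) ^+ k).
Proof.
exact (@del_delbar_OmegaX R _ (prod_complex_structure s1 s2 a b c) (chart_image c)
  [set lshift m2 i | i : 'I_m1]%SET [set rshift m1 i | i : 'I_m2]%SET
  f1 f2 e1 e2 (toC a) (toC b) (toC t) toCb0 (chart_image_prod_open hM1 hM2 (c := c))
  (fun y _ => lifted_contact1_form y) (fun y _ => lifted_contact2_form y)
  (fun y _ => lifted_eta1_form y) (fun y _ => lifted_eta2_form y)
  d_lifted_contact1 d_lifted_contact2 d_lifted_eta1 d_lifted_eta2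
  lifted_contact1_type lifted_contact2_type
  e1bar_type e2bar_type e1hol_type e2hol_type Omega_type v k).
Qed.

Lemma prod_form_exp y k : Omega y ^+ k.+1 =
  (f1 y + f2 y) ^+ k.+1 + (k.+1%:R * toC t) *: ((f1 y + f2 y) ^+ k * (e1 y * e2 y)).
Proof.
exact: (@Omega_exp R _ setT [set lshift m2 i | i : 'I_m1]%SET
  [set rshift m1 i | i : 'I_m2]%SET f1 f2 e1 e2 (toC t)
  (fun y _ => lifted_contact1_form y) (fun y _ => lifted_contact2_form y)
  (fun y _ => lifted_eta1_form y) (fun y _ => lifted_eta2_form y) y k I).
Qed.

End ProductForms.

(** * The equivalence *)

Section HermitianForm.
Variables (R : realType) (m : nat) (J G : 'M[R]_m).
Hypotheses (J_sqr : J *m J = - 1%:M) (G_sym : G^T = G) (G_inv : J *m G *m J^T = G).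
Hypothesis G_pos : forall X : 'rV[R]_m, X != 0 -> 0 < (X *m G *m X^T) 0 0.

Lemma hermitian_form_antisym : (J *m G)^T = - (J *m G).
Proof.
rewrite trmx_mul G_sym -{2}G_inv !mulmxA J_sqr mulNmx mul1mx mulNmx opprK.
by [].
Qed.

Lemma hermitian_form_invariant : J *m (J *m G) = - (J *m G *m J^T).
Proof. by rewrite G_inv mulmxA J_sqr mulNmx mul1mx. Qed.

(** A positive definite matrix has no kernel. *)
Lemma hermitian_form_unit : J *m G \in unitmx.
Proof.
rewrite unitmx_mul; apply/andP; split.
  have : J *m (- J) = 1%:M by rewrite mulmxN J_sqr opprK.
  by case/mulmx1_unit.
rewrite unitmxE unitfE; apply/negP => /det0P[v nz vG].
by have := G_pos nz; rewrite vG mul0mx mxE ltxx.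
Qed.

End HermitianForm.

Section Criterion.
Variables (R : realType) (n1 n2 k : nat).
Variables (M1 : atlas R (2 * n1 + 1)) (M2 : atlas R (2 * n2 + 1)).
Variables (s1 : contact_data M1) (s2 : contact_data M2) (a b t : R).
Hypotheses (hM1 : smooth_manifold M1) (hM2 : smooth_manifold M2).
Hypotheses (hs1 : sasakian s1) (hs2 : sasakian s2) (b0 : b != 0) (t0 : t != 0).
Hypothesis dims : (n1 + n2 = k.+2)%N.
Local Notation C := (R[i] : numClosedFieldType).
Local Notation m := (2 * n1 + 1 + (2 * n2 + 1))%N.
Local Notation J := (prod_complex_structure s1 s2 a b).
Local Notation toC := (real_complex R).
Variable G : local_field (prod_atlas M1 M2) 'M[R]_m.
Hypothesis hG : hermitian_metric J G.
Hypothesis hGOmega : forall c x, chart_image c x ->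
  fundamental_form J G c x = prod_fundamental_form s1 s2 t c x.
Variables (c : Defs.index (prod_atlas M1 M2)) (x : 'rV[R]_m).
Hypothesis Ux : chart_image c x.

Let f1 := lifted_contact1 s1 c.
Let f2 := lifted_contact2 s2 c.
Let e1 := lifted_eta1 s1 c.
Let e2 := lifted_eta2 s2 c.
Let Omega (y : 'rV[R]_m) : grassmann C m := f1 y + f2 y + toC t *: (e1 y * e2 y).

Let toC_fundamental y : chart_image c y ->
  ext_toC (fundamental_form J G c y) = Omega y.
Proof. by move=> Uy; rewrite hGOmega // ext_toC_prod_fundamental_form. Qed.

Let OmegaE y : chart_image c y -> Omega y = two_form (map_mx toC (J c y *m G c y)).
Proof. by move=> Uy; rewrite -toC_fundamental // -complexify_two_form. Qed.

Let J_sqr y : chart_image c y -> J c y *m J c y = - 1%:M.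
Proof. exact: prod_complex_structure_sqr. Qed.

Let G_sym y : chart_image c y -> (G c y)^T = G c y.
Proof. by move=> Uy; have [[_ /(_ _ _ Uy) []]] := hG. Qed.

Let G_inv y : chart_image c y -> J c y *m G c y *m (J c y)^T = G c y.
Proof. by move=> Uy; have [_ /(_ _ _ Uy)] := hG. Qed.

Let Omega_type y : chart_image c y -> of_type (J c y) 1 1 (Omega y).
Proof.
move=> Uy; rewrite OmegaE //; apply: of_type_two_form.
- exact: J_sqr.
- exact: (hermitian_form_antisym (J_sqr Uy) (G_sym Uy) (G_inv Uy)).
- exact: (hermitian_form_invariant (J_sqr Uy) (G_inv Uy)).
Qed.

Let Omega_top_neq0 : Omega x ^+ (n1 + n2).+1 != 0.
Proof.
rewrite OmegaE //; apply: two_form_nondegenerate.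
- by rewrite map_trmx (hermitian_form_antisym (J_sqr Ux) (G_sym Ux) (G_inv Ux)) map_mxN.
- rewrite map_unitmx; apply: (hermitian_form_unit (J_sqr Ux)).
  by have [[_ /(_ _ _ Ux) []]] := hG.
- by lia.
Qed.

Let f1_nil : f1 x ^+ n1.+1 = 0.
Proof.
apply: (form_in_large _ (form_inX _ (lifted_contact1_form s1 c x))).
by rewrite card_imset ?card_ord; [lia|apply: lshift_inj].
Qed.

Let f2_nil : f2 x ^+ n2.+1 = 0.
Proof.
apply: (form_in_large _ (form_inX _ (lifted_contact2_form s2 c x))).
by rewrite card_imset ?card_ord; [lia|apply: rshift_inj].
Qed.

Let f12 : GRing.comm (f1 x) (f2 x).
Proof. by apply: form_in_even_comm (lifted_contact1_form s1 c x) _. Qed.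

Let expE j : Omega x ^+ j.+1 = (f1 x + f2 x) ^+ j.+1 +
  (j.+1%:R * toC t) *: ((f1 x + f2 x) ^+ j * (e1 x * e2 x)).
Proof. exact: prod_form_exp. Qed.

Let top_neq0 : f1 x ^+ n1 * f2 x ^+ n2 * (e1 x * e2 x) != 0.
Proof.
move: Omega_top_neq0; rewrite expE.
have -> : (f1 x + f2 x) ^+ (n1 + n2).+1 = 0.
  have := nilpotent_sum_exp0 (p := 0) (q := 0) (M := (n1 + n2).+1) f12 f1_nil f2_nil.
  by rewrite !expr0 !mul1r; apply; lia.
have -> : (f1 x + f2 x) ^+ (n1 + n2) = (f1 x ^+ n1 * f2 x ^+ n2) *+ 'C(n1 + n2, n1 - 0).
  have := nilpotent_sum_exp (p := 0) (q := 0) (M := (n1 + n2)) f12 f1_nil f2_nil.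
  by rewrite !expr0 !mul1r; apply; lia.
rewrite add0r; apply: contraNN => /eqP z.
by rewrite [_ *+ 'C(_, _) * _]mulrnAl z mul0rn scaler0.
Qed.

Let i2b_neq0 : 'i / (2%:R * toC b) != 0 :> C.
Proof. by rewrite mulf_neq0 ?neq0Ci // invr_neq0 // mulf_neq0 ?pnatr_eq0 // fmorph_eq0. Qed.

Let polynomialE : gauduchon_polynomial n1 n2 (toC a) (toC b) = 0 <->
  gauduchon_polynomial n1 n2 a b = 0.
Proof.
have -> : gauduchon_polynomial n1 n2 (toC a) (toC b) = toC (gauduchon_polynomial n1 n2 a b).
  rewrite /gauduchon_polynomial !(rmorphD, rmorphN, rmorphM, rmorphXn, rmorph_nat, rmorph1).
  by [].
by split=> [/eqP|->]; rewrite ?rmorph0 // fmorph_eq0 => /eqP.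
Qed.

Let del_delbar_exp (v : 'rV[R]_m -> grassmann C m) j : (j.+2 <= m)%N ->
  (forall y, chart_image c y -> v y = Omega y ^+ j.+1) ->
  del (J c) (delbar (J c) v) x =
  (j.+1%:R * toC t * ('i / (2%:R * toC b))) *:
    (quadric (f1 x) (f2 x) (toC a) (toC b) * (f1 x + f2 x) ^+ j).
Proof.
move=> lej vO; exact: (del_delbar_prod_form hM1 hM2 hs1 hs2 b0 Omega_type lej vO Ux).
Qed.

Let coef_neq0 j : j.+1%:R * toC t * ('i / (2%:R * toC b)) != 0 :> C.
Proof. by rewrite mulf_neq0 ?i2b_neq0 // mulf_neq0 ?pnatr_eq0 // fmorph_eq0. Qed.

(** The first summand F^(k+1) of Omega^(k+1) contributes nothing: its product with
    the quadric has degree n1 + n2 + 1 in f1 and f2. *)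
Lemma first_gauduchon_at :
  wedge (del (J c) (delbar (J c) (fun y => ext_toC (fundamental_form J G c y))) x)
    (wedge_pow (ext_toC (fundamental_form J G c x)) k.+1) = 0 <->
  gauduchon_polynomial n1 n2 a b = 0.
Proof.
have le2 : (2 <= m)%N by lia.
have vO y : chart_image c y -> ext_toC (fundamental_form J G c y) = Omega y ^+ 1.
  by move=> Uy; rewrite toC_fundamental // expr1.
rewrite (del_delbar_exp le2 vO) wedge_powE toC_fundamental // expE expr0 mulr1.
apply: iff_trans polynomialE.
have c0 : 1%:R * toC t * ('i / (2%:R * toC b)) * (k.+1%:R * toC t) != 0 :> C.
  by rewrite mulf_neq0 ?(coef_neq0 0) // mulf_neq0 ?pnatr_eq0 // fmorph_eq0.
apply: iff_trans (quadric_exp_eq0 f12 f1_nil f2_nil (toC a) (toC b) dims c0 top_neq0).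
rewrite -[wedge _ _]/((_ : grassmann C m) * (_ : grassmann C m)) mulrDr -!scalerAl.
rewrite (quadric_exp_over f12 f1_nil f2_nil _ _ dims) scaler0 add0r -scalerAr scalerA.
by rewrite [quadric _ _ _ _ * (_ * _)]mulrA.
Qed.

Lemma astheno_kahler_at :
  del (J c) (delbar (J c)
    (fun y => wedge_pow (ext_toC (fundamental_form J G c y)) k.+1)) x = 0 <->
  gauduchon_polynomial n1 n2 a b = 0.
Proof.
have lek : (k.+2 <= m)%N by lia.
have vO y : chart_image c y ->
    wedge_pow (ext_toC (fundamental_form J G c y)) k.+1 = Omega y ^+ k.+1.
  by move=> Uy; rewrite -toC_fundamental // -wedge_powE.
rewrite (del_delbar_exp lek vO); apply: iff_trans polynomialE.
have top0 : f1 x ^+ n1 * f2 x ^+ n2 * 1 != 0.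
  by apply: contraNneq top_neq0; rewrite mulr1 => ->; rewrite mul0r.
have := quadric_exp_eq0 f12 f1_nil f2_nil (toC a) (toC b) dims (coef_neq0 k) top0.
by rewrite mulr1.
Qed.

End Criterion.

Theorem theorem4p1 (R : realType) (n1 n2 n : nat)
  (M1 : atlas R (2 * n1 + 1)) (M2 : atlas R (2 * n2 + 1))
  (hM1 : smooth_manifold M1) (hM2 : smooth_manifold M2)
  (s1 : contact_data M1) (s2 : contact_data M2)
  (hs1 : sasakian s1) (hs2 : sasakian s2)
  (a b t : R) (hb : b != 0) (ht : t != 0) (htb : 0 < t / b)
  (hn : n = (n1 + n2 + 1)%N) (hn6 : (6 < 2 * n)%N) :
  let M := prod_atlas M1 M2 in
  let J := prod_complex_structure s1 s2 a b in
  let Omega := prod_fundamental_form s1 s2 t in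
  forall (G : local_field M 'M[R]_(2 * n1 + 1 + (2 * n2 + 1)))
    (hG : hermitian_metric J G)
    (hGOmega : forall c x, chart_image c x ->
       fundamental_form J G c x = Omega c x),
  (first_gauduchon n J G <-> astheno_kahler n J G) /\
  (astheno_kahler n J G <->
     n1%:R * (n1%:R - 1) + 2 * a * n1%:R * n2%:R
       + (a ^+ 2 + b ^+ 2) * (n2%:R * (n2%:R - 1)) = 0).
Proof.
move=> M J Omega G hG hGOmega.
(* 2 n > 6 gives n1 + n2 >= 3; both conditions involve the exponent n - 2 = k + 1. *)
have [k dims] : exists k, (n1 + n2 = k.+2)%N by exists (n - 3)%N; lia.
have enk : (n - 2 = k.+1)%N by lia.
have [c0 [x0 Ux0]] := chart_image_prod_nonempty hM1 hM2.
have gauduchon_iff : first_gauduchon n J G <-> gauduchon_polynomial n1 n2 a b = 0.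
  rewrite /first_gauduchon enk; split=> [/(_ c0 x0 Ux0)|P0 c x Ux].
    exact: (first_gauduchon_at hM1 hM2 hs1 hs2 hb ht dims hG hGOmega Ux0).1.
  exact: (first_gauduchon_at hM1 hM2 hs1 hs2 hb ht dims hG hGOmega Ux).2.
have astheno_iff : astheno_kahler n J G <-> gauduchon_polynomial n1 n2 a b = 0.
  rewrite /astheno_kahler enk; split=> [/(_ c0 x0 Ux0)|P0 c x Ux].
    exact: (astheno_kahler_at hM1 hM2 hs1 hs2 hb ht dims hG hGOmega Ux0).1.
  exact: (astheno_kahler_at hM1 hM2 hs1 hs2 hb ht dims hG hGOmega Ux).2.
split=> //; exact: iff_trans gauduchon_iff (iff_sym astheno_iff).
Qed.
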